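(* Let $p\colon E\to B$ be a weak fibration and let $F=p^{-1}(b)$ be the fiber at $b\in B$. Let $i\colon F\to E$ be the inclusion. Then for any basepoint $e$ of $F$, there is an exact sequence (of pointed sets) $$\cdots\to\pi_{n+1}(B,b)\xrightarrow{\Delta'}\pi_n(F,e)\xrightarrow{i_*}\pi_n(E,e)\xrightarrow{p_*}\pi_n(B,b)\to\cdots$$ $$\cdots\to\pi_1(B,b)\xrightarrow{\Delta'}\pi_0(F,e)\xrightarrow{i_*}\pi_0(E,e)\xrightarrow{p_*}\pi_0(B,b)$$ for suitable maps $\Delta'\colon\pi_{n+1}(B,b)\to\pi_n(F,e)$, $n\ge0$.
   Context: All spaces are diffeological spaces and maps are smooth; $F$ has the subspace diffeology; $I=[0,1]$, $I^n$ and their subsets have the subspace diffeology from $\mathbf{R}^n$. $\pi_n(X,x_0)$ is the set of homotopy classes of smooth maps $(I^n,\partial I^n)\to(X,x_0)$ (homotopies are smooth maps $I^n\times I\to X$ sending $\partial I^n\times I$ to $x_0$), pointed by the class of the constant map; $\pi_0(X,x_0)$ is the set of smooth path components pointed by that of $x_0$. Let $K$ be a cubical subcomplex of $I^n$ (a union of faces) and $0<\epsilon\le1/2$. A smooth map $f\colon K\to Y$ is $\epsilon$-tame if $f(t_1,\dots,t_j,\dots,t_n)=f(t_1,\dots,t_{j-1},\alpha,t_{j+1},\dots,t_n)$ for all $(t_1,\dots,t_n)\in K$, all $j$ and all $\alpha\in\{0,1\}$ with $|t_j-\alpha|\le\epsilon$; it is tame if it is $\epsilon$-tame for some $\epsilon>0$.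 For $n\ge1$ let $L^{n-1}=\partial I^{n-1}\times I\cup I^{n-1}\times\{0\}\subset I^n$. A smooth map $p\colon E\to B$ is a weak fibration if for every $n\ge1$ and every pair of tame maps $f\colon L^{n-1}\to E$, $g\colon I^n\to B$ with $p\circ f=g|L^{n-1}$ there is a smooth map $G\colon I^n\to E$ with $G|L^{n-1}=f$ and $p\circ G=g$. In the paper $\Delta'$ arises as follows: for $n\ge1$, $p_*\colon\pi_n(E,F,e)\to\pi_n(B,b,b)=\pi_n(B,b)$ is a bijection, and $\Delta'$ is the composite of its inverse with the boundary map $\Delta\colon\pi_n(E,F,e)\to\pi_{n-1}(F,e)$ given by restriction to $I^{n-1}\times\{0\}$, where $\pi_n(E,F,e)$ is the set of homotopy classes of smooth maps of triples $(I^n,\partial I^n,J^{n-1})\to(E,F,e)$ and $J^{n-1}=\partial I^{n-1}\times I\cup I^{n-1}\times\{1\}$. *)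

(* Defs.v *)
From HB Require Import structures.
From mathcomp Require Import all_boot all_order all_algebra.
From mathcomp Require Import boolp classical_sets functions reals topology.
From mathcomp Require Import normedtype landau derive.

Set Implicit Arguments.
Unset Strict Implicit.
Unset Printing Implicit Defensive.
Import Order.TTheory GRing.Theory Num.Theory.
Import numFieldNormedType.Exports.
Local Open Scope classical_set_scope.
Local Open Scope ring_scope.

Section Ck.
Context {R : realType}.
Implicit Types n m k : nat.

Fixpoint Ck k n (U : set 'rV[R]_n) (f : 'rV[R]_n -> R) : Prop :=
  if k is k'.+1 then
    (forall x, U x -> differentiable f x) /\ (forall v, Ck k' U ('D_v f))
  else forall x, U x -> {for x, continuous f}.

Definition Cinfty n (U : set 'rV[R]_n) (f : 'rV[R]_n -> R) : Prop :=
  forall k, Ck k U f.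

Lemma near_eq_continuous_at (T : topologicalType) (f g : T -> R) (x : T) :
  (\forall y \near x, f y = g y) ->
  {for x, continuous f} -> {for x, continuous g}.
Proof.
move=> fg cf; have fgx : f x = g x := nbhs_singleton fg.
rewrite /prop_for /continuous_at -fgx; apply: cvg_trans cf.
exact: near_eq_cvg.
Qed.

Lemma near_eq_differentiable (V W : normedModType R) (f g : V -> W) (x : V) :
  (\forall y \near x, f y = g y) -> differentiable f x -> differentiable g x.
Proof.
move=> fg df.
have -> : g = f + (g - f) by apply/funext => y; rewrite !fctE addrC subrK.
apply: differentiableD => //.
have H : (g - f) \o shift x = cst ((g - f) x) + \0 +o_ 0 id.
  apply/eqaddoP => e e0; have := fg; rewrite (near_shift 0 x) subr0 => nfg.
  near=> y; have E : f x = g x := nbhs_singleton fg.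
  have Ey : f (y + x) = g (y + x) by near: y; exact: nfg.
  rewrite (_ : (_ - _) y = 0) ?normr0 ?mulr_ge0 // ?ltW //.
  by rewrite !fctE /= Ey E !subrr !addr0 subr0.
have c0 : continuous (\0 : {linear V -> W}) by move=> z; exact: cst_continuous.
by apply/diff_locallyP; rewrite (diff_unique c0 H).
Unshelve. all: by end_near. Qed.

Lemma Ck_sub k n (U V : set 'rV[R]_n) f : V `<=` U -> Ck k U f -> Ck k V f.
Proof.
move=> VU; elim: k f => [|k IH] f /= Hf; first by move=> x /VU; exact: Hf.
case: Hf => H1 H2; split=> [x /VU /H1 //|v]; exact/IH/H2.
Qed.

Lemma Ck_local k n (U : set 'rV[R]_n) f :
  (forall x, U x -> exists V, V x /\ Ck k V f) -> Ck k U f.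
Proof.
elim: k f => [|k IH] f /= Hf.
  by move=> x /Hf [V [Vx]]; apply.
split=> [x /Hf [V [Vx [H _]]]|v]; first exact: H.
by apply: IH => x /Hf [V [Vx [_ H]]]; exists V.
Qed.

Lemma Ck_ext k n (U : set 'rV[R]_n) f g : open U ->
  (forall x, U x -> f x = g x) -> Ck k U f -> Ck k U g.
Proof.
move=> oU; have nfg (f1 g1 : 'rV[R]_n -> R) : (forall x, U x -> f1 x = g1 x) ->
    forall x : 'rV[R]_n, U x -> \forall y \near x, f1 y = g1 y.
  move=> fg x Ux; near=> y; apply: fg; near: y; exact: open_nbhs_nbhs.
elim: k f g => [|k IH] f g fg /= Hf.
  move=> x Ux; exact: near_eq_continuous_at (nfg _ _ fg x Ux) (Hf x Ux).
case: Hf => H1 H2; split=> [x Ux|v].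
  exact: near_eq_differentiable (nfg _ _ fg x Ux) (H1 x Ux).
apply: IH (H2 v) => x Ux; exact/near_eq_derive/nfg.
Unshelve. all: by end_near. Qed.

Lemma Ck_le k n (U : set 'rV[R]_n) f : Ck k.+1 U f -> Ck k U f.
Proof.
elim: k f => [|k IH] f [H1 H2]; last by split=> // v; exact/IH/H2.
by move=> x Ux; apply: differentiable_continuous; exact: H1.
Qed.

Lemma Ck_cst k n (U : set 'rV[R]_n) (c : R) : Ck k U (cst c).
Proof.
elim: k c => [|k IH] c /=; first by move=> x _; exact: cst_continuous.
split=> [x _|v]; first exact: differentiable_cst.
rewrite (_ : 'D_v _ = cst 0) //; apply/funext => x; exact: derive_cst.
Qed.

Lemma derive_coord n j (v x : 'rV[R]_n) :
  'D_v (fun y : 'rV[R]_n => y 0 j) x = v 0 j.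
Proof.
apply: cvg_lim => //=; apply: cvg_near_cst; near=> h.
rewrite !mxE addrK /GRing.scale /= mulrA mulVf ?mul1r //.
by near: h; exact: nbhs_dnbhs_neq.
Unshelve. all: by end_near. Qed.

Lemma Ck_coord k n (U : set 'rV[R]_n) j :
  Ck k U (fun x : 'rV[R]_n => x 0 j).
Proof.
case: k => [|k] /=; first by move=> x _; exact: coord_continuous.
split=> [x _|v]; first exact: differentiable_coord.
rewrite (_ : 'D_v _ = cst (v 0 j)); first exact: Ck_cst.
by apply/funext => x; exact: derive_coord.
Qed.

Lemma CkD k n (U : set 'rV[R]_n) f g : open U ->
  Ck k U f -> Ck k U g -> Ck k U (fun x => f x + g x).
Proof.
move=> oU; elim: k f g => [|k IH] f g /=.
  by move=> Hf Hg x Ux; exact: (continuousD (Hf x Ux) (Hg x Ux)).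
move=> [f1 f2] [g1 g2]; split=> [x Ux|v].
  exact: (differentiableD (f1 x Ux) (g1 x Ux)).
apply: (Ck_ext oU _ (IH _ _ (f2 v) (g2 v))) => x Ux.
by apply/esym; apply: deriveD; apply/diff_derivable; [exact: f1|exact: g1].
Qed.

Lemma CkM k n (U : set 'rV[R]_n) f g : open U ->
  Ck k U f -> Ck k U g -> Ck k U (fun x => f x * g x).
Proof.
move=> oU; elim: k f g => [|k IH] f g.
  by move=> Hf Hg x Ux; exact: (continuousM (Hf x Ux) (Hg x Ux)).
move=> Hf Hg; have [f1 f2] := Hf; have [g1 g2] := Hg; split=> [x Ux|v].
  exact: (differentiableM (f1 x Ux) (g1 x Ux)).
have H := CkD oU (IH _ _ (Ck_le Hf) (g2 v)) (IH _ _ (Ck_le Hg) (f2 v)).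
apply: (Ck_ext oU _ H) => x Ux.
apply/esym; apply: (@deriveM _ _ f g x v); apply/diff_derivable.
  exact: f1.
exact: g1.
Qed.

Lemma Ck_sum k n (U : set 'rV[R]_n) m (f : 'I_m -> 'rV[R]_n -> R) : open U ->
  (forall i, Ck k U (f i)) -> Ck k U (fun x => \sum_(i < m) f i x).
Proof.
move=> oU; elim: m f => [|m IH] f Hf.
  apply: (Ck_ext oU _ (Ck_cst k U 0)) => x _; by rewrite big_ord0.
have H := CkD oU (IH _ (fun i => Hf (widen_ord (leqnSn m) i))) (Hf ord_max).
by apply: (Ck_ext oU _ H) => x _; rewrite big_ord_recr.
Qed.

Lemma row_sum_coord n m (h : 'rV[R]_n -> 'rV[R]_m) :
  h = \sum_(i < m) (fun x => h x 0 i *: (delta_mx 0 i : 'rV[R]_m)).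
Proof.
by apply/funext => x; rewrite {1}[h x]row_sum_delta fct_sumE.
Qed.

Lemma continuous_row n m (h : 'rV[R]_n -> 'rV[R]_m) (x : 'rV[R]_n) :
  (forall i, {for x, continuous (fun y => h y 0 i)}) -> {for x, continuous h}.
Proof.
move=> Hh; rewrite [h]row_sum_coord; elim/big_ind : _ => [|g1 g2 H1 H2|i _].
- exact: cst_continuous.
- exact: continuousD.
- exact: (@cvgZr_tmp _ _ _ _ _ _ _ _ (Hh i)).
Qed.

Lemma Ck_comp k n m (V : set 'rV[R]_n) (U : set 'rV[R]_m)
    (h : 'rV[R]_n -> 'rV[R]_m) f : open V -> open U ->
  (forall x, V x -> U (h x)) -> (forall i, Ck k V (fun x => h x 0 i)) ->
  Ck k U f -> Ck k V (f \o h).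
Proof.
move=> oV oU VU; elim: k f => [|k IH] f Hh Hf /=.
  move=> x Vx; apply: continuous_comp; last exact/Hf/VU.
  by apply: continuous_row => i; exact: (Hh i).
have dh x : V x -> differentiable h x.
  move=> Vx; rewrite [h]row_sum_coord; apply: differentiable_sum => i.
  by apply: differentiableZl; exact: (Hh i).1.
have [f1 f2] := Hf; split=> [x Vx|v].
  by apply: differentiable_comp; [exact: dh|exact/f1/VU].
have H : Ck k V (fun x => \sum_(i < m)
    'D_v (fun y => h y 0 i) x * ('D_(delta_mx 0 i) f \o h) x).
  apply: Ck_sum => // i; apply: CkM => //; first exact: (Hh i).2.
  by apply: IH; [move=> j; exact/Ck_le/Hh|exact: f2].
apply: (Ck_ext oV _ H) => x Vx; apply/esym.
have dfh := f1 _ (VU x Vx).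
rewrite deriveE; last by apply: differentiable_comp => //; exact: dh.
rewrite diff_comp //=; last exact: dh.
rewrite [X in 'd f _ X]row_sum_delta linear_sum; apply: eq_bigr => i _.
rewrite linearZ /= [in RHS]deriveE //; last exact: (Hh i).1.
rewrite [in RHS]deriveE //; congr (_ * _).
pose c := fun M : 'rV[R]_m => M 0 i.
rewrite (_ : (fun y => h y 0 i) = c \o h) //.
rewrite (diff_comp (dh x Vx) (differentiable_coord _ _ _)) /=.
rewrite -(deriveE ('d h x v) (differentiable_coord (h x) 0 i)).
by rewrite derive_coord.
Qed.
End Ck.

(* A plot on U is represented by a total function on 'rV[R]_n, of which only
   the values on U matter (plot_ext). *)
HB.mixin Record isDiffeological (R : realType) (X : Type) := {
  plot : forall n, set 'rV[R]_n -> ('rV[R]_n -> X) -> Prop;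
  plot_open : forall n (U : set 'rV[R]_n) u, plot n U u -> open U;
  plot_ext : forall n (U : set 'rV[R]_n) u v,
    (forall x, U x -> u x = v x) -> plot n U u -> plot n U v;
  plot_cst : forall n (U : set 'rV[R]_n) (x : X), open U -> plot n U (cst x);
  plot_local : forall n (U : set 'rV[R]_n) u, open U ->
    (forall x, U x -> exists V, [/\ V x, V `<=` U & plot n V u]) -> plot n U u;
  plot_comp : forall n m (U : set 'rV[R]_n) (V : set 'rV[R]_m) u
    (h : 'rV[R]_m -> 'rV[R]_n), open V -> (forall x, V x -> U (h x)) ->
    (forall j, Cinfty V (fun x => h x 0 j)) -> plot n U u -> plot m V (u \o h)
}.

#[short(type="diffeologicalType")]
HB.structure Definition Diffeological (R : realType) :=
  {X of isDiffeological R X}.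

Arguments plot {R s n}.
Arguments plot_open {R s n U u}.
Arguments plot_ext {R s n U u v}.
Arguments plot_cst {R s n U}.
Arguments plot_local {R s n U u}.
Arguments plot_comp {R s n m U V u h}.

Section Euclidean.
Variables (R : realType) (d : nat).

Let eplot n (U : set 'rV[R]_n) (u : 'rV[R]_n -> 'rV[R]_d) : Prop :=
  open U /\ forall j, Cinfty U (fun x => u x 0 j).

Let eplot_open n (U : set 'rV[R]_n) u : eplot U u -> open U.
Proof. by case. Qed.

Let eplot_ext n (U : set 'rV[R]_n) u v :
  (forall x, U x -> u x = v x) -> eplot U u -> eplot U v.
Proof.
move=> uv [oU Hu]; split=> // j k.
by apply: (Ck_ext oU _ (Hu j k)) => x Ux; rewrite uv.
Qed.

Let eplot_cst n (U : set 'rV[R]_n) (x : 'rV[R]_d) : open U -> eplot U (cst x).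
Proof. by move=> oU; split=> // j k; exact: Ck_cst. Qed.

Let eplot_local n (U : set 'rV[R]_n) u : open U ->
  (forall x, U x -> exists V, [/\ V x, V `<=` U & eplot V u]) -> eplot U u.
Proof.
move=> oU H; split=> // j k; apply: Ck_local => x /H [V [Vx _ [_ Hu]]].
by exists V; split=> //; exact: Hu.
Qed.

Let eplot_comp n m (U : set 'rV[R]_n) (V : set 'rV[R]_m) u
    (h : 'rV[R]_m -> 'rV[R]_n) : open V -> (forall x, V x -> U (h x)) ->
  (forall j, Cinfty V (fun x => h x 0 j)) -> eplot U u -> eplot V (u \o h).
Proof.
move=> oV VU Hh [oU Hu]; split=> // j k.
exact: (Ck_comp oV oU VU (fun i => Hh i k) (Hu j k)).
Qed.

HB.instance Definition _ := isDiffeological.Build R 'rV[R]_d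
  eplot_open eplot_ext eplot_cst eplot_local eplot_comp.
End Euclidean.

Section Subspace.
Variables (R : realType) (X : diffeologicalType R) (A : set X).

Let splot n (U : set 'rV[R]_n) (u : 'rV[R]_n -> A) : Prop :=
  plot U (val \o u).

Let splot_open n (U : set 'rV[R]_n) u : splot U u -> open U.
Proof. exact: plot_open. Qed.

Let splot_ext n (U : set 'rV[R]_n) u v :
  (forall x, U x -> u x = v x) -> splot U u -> splot U v.
Proof. by move=> uv; apply: plot_ext => x Ux /=; rewrite uv. Qed.

Let splot_cst n (U : set 'rV[R]_n) (x : A) : open U -> splot U (cst x).
Proof. exact: plot_cst. Qed.

Let splot_local n (U : set 'rV[R]_n) u : open U ->
  (forall x, U x -> exists V, [/\ V x, V `<=` U & splot V u]) -> splot U u.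
Proof. exact: plot_local. Qed.

Let splot_comp n m (U : set 'rV[R]_n) (V : set 'rV[R]_m) u
    (h : 'rV[R]_m -> 'rV[R]_n) : open V -> (forall x, V x -> U (h x)) ->
  (forall j, Cinfty V (fun x => h x 0 j)) -> splot U u -> splot V (u \o h).
Proof. by move=> oV VU Hh; exact: plot_comp. Qed.

HB.instance Definition _ := isDiffeological.Build R (set_type A)
  splot_open splot_ext splot_cst splot_local splot_comp.
End Subspace.

Section Product.
Variables (R : realType) (X Y : diffeologicalType R).

Let pplot n (U : set 'rV[R]_n) (u : 'rV[R]_n -> X * Y) : Prop :=
  plot U (fst \o u) /\ plot U (snd \o u).

Let pplot_open n (U : set 'rV[R]_n) u : pplot U u -> open U.
Proof. by move=> [+ _]; exact: plot_open. Qed.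

Let pplot_ext n (U : set 'rV[R]_n) u v :
  (forall x, U x -> u x = v x) -> pplot U u -> pplot U v.
Proof.
by move=> uv [u1 u2]; split; [apply: plot_ext u1|apply: plot_ext u2] => x Ux /=;
  rewrite uv.
Qed.

Let pplot_cst n (U : set 'rV[R]_n) (x : X * Y) : open U -> pplot U (cst x).
Proof. by move=> oU; split; exact: plot_cst. Qed.

Let pplot_local n (U : set 'rV[R]_n) u : open U ->
  (forall x, U x -> exists V, [/\ V x, V `<=` U & pplot V u]) -> pplot U u.
Proof.
by move=> oU H; split; apply: plot_local => // x /H [V [Vx VU [u1 u2]]];
  exists V; split.
Qed.

Let pplot_comp n m (U : set 'rV[R]_n) (V : set 'rV[R]_m) u
    (h : 'rV[R]_m -> 'rV[R]_n) : open V -> (forall x, V x -> U (h x)) ->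
  (forall j, Cinfty V (fun x => h x 0 j)) -> pplot U u -> pplot V (u \o h).
Proof.
move=> oV VU Hh [u1 u2]; split.
- exact: (plot_comp (u := fst \o u) oV VU Hh u1).
- exact: (plot_comp (u := snd \o u) oV VU Hh u2).
Qed.

HB.instance Definition _ := isDiffeological.Build R (X * Y)%type
  pplot_open pplot_ext pplot_cst pplot_local pplot_comp.
End Product.

Definition in_sub (T : Type) (A : set T) (x : T) (Ax : A x) : A :=
  exist _ x (mem_set Ax).

Definition smooth (R : realType) (X Y : diffeologicalType R) (f : X -> Y)
    : Prop :=
  forall n (U : set 'rV[R]_n) (u : 'rV[R]_n -> X), plot U u -> plot U (f \o u).

Record smooth_map (R : realType) (X Y : diffeologicalType R) := SmoothMap {
  smooth_fun :> X -> Y;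
  smooth_funP : smooth smooth_fun
}.

Section SmoothMaps.
Context {R : realType}.
Implicit Types X Y Z : diffeologicalType R.

Lemma smooth_comp X Y Z (g : smooth_map Y Z) (f : smooth_map X Y) :
  smooth (g \o f).
Proof. by move=> n U u /(smooth_funP f) /(smooth_funP g). Qed.
Definition comp_map X Y Z (g : smooth_map Y Z) (f : smooth_map X Y) :=
  SmoothMap (smooth_comp g f).

Lemma smooth_cst X Y (y : Y) : smooth (fun _ : X => y).
Proof. by move=> n U u /plot_open oU; exact: plot_cst. Qed.
Definition cst_map X Y (y : Y) := SmoothMap (@smooth_cst X Y y).

Lemma smooth_val X (A : set X) : smooth (fun a : A => val a : X).
Proof. by []. Qed.
Definition incl_map X (A : set X) := SmoothMap (@smooth_val X A).

Definition corestr_fun X Y (A : set Y) (f : smooth_map X Y)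
    (fA : forall x, A (f x)) (x : X) : A :=
  in_sub (fA x).
Lemma smooth_corestr X Y (A : set Y) (f : smooth_map X Y)
  (fA : forall x, A (f x)) : smooth (corestr_fun fA).
Proof. by move=> n U u /(smooth_funP f). Qed.
Definition corestr_map X Y (A : set Y) (f : smooth_map X Y)
    (fA : forall x, A (f x)) : smooth_map X A :=
  SmoothMap (smooth_corestr fA).

End SmoothMaps.

Section Cubes.
Variable R : realType.

Definition cube n : set 'rV[R]_n := [set t | forall j, 0 <= t 0 j <= 1].
Arguments cube : clear implicits.

Lemma cube_cst n (a : R) : 0 <= a <= 1 -> cube n (const_mx a).
Proof. by move=> Ha j; rewrite mxE. Qed.

Lemma le001 : (0 : R) <= (0 : R) <= 1. Proof. by rewrite lexx ler01. Qed.
Lemma le011 : (0 : R) <= (1 : R) <= 1. Proof. by rewrite lexx ler01. Qed.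

Definition cube0 n : cube n := in_sub (@cube_cst n _ le001).
Definition cube1 n : cube n := in_sub (@cube_cst n _ le011).

Definition bd n (t : 'rV[R]_n) : Prop := exists j, t 0 j = 0 \/ t 0 j = 1.

(* A point t of I^n.+1 is (front t, t 0 ord_max) in I^n * I. *)
Definition front n (t : 'rV[R]_n.+1) : 'rV[R]_n := \row_j t 0 (lift ord_max j).

(* L^n = (bd I^n * I) U (I^n * {0}) and J^n = (bd I^n * I) U (I^n * {1}) *)
Definition Lset n : set 'rV[R]_n.+1 :=
  [set t | cube n.+1 t /\ (bd (front t) \/ t 0 ord_max = 0)].
Arguments Lset : clear implicits.

Definition Jset n : set 'rV[R]_n.+1 :=
  [set t | cube n.+1 t /\ (bd (front t) \/ t 0 ord_max = 1)].
Arguments Jset : clear implicits.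

Definition L_incl n (x : Lset n) : cube n.+1 :=
  in_sub (proj1 (set_valP x)).

Definition face_row n (t : 'rV[R]_n) : 'rV[R]_n.+1 :=
  \row_j (if unlift ord_max j is Some i then t 0 i else 0).

Lemma face_row_cube n (t : cube n) : cube n.+1 (face_row (val t)).
Proof.
move=> j; rewrite mxE; case: unlift => [i|]; last exact: le001.
exact: (set_valP t).
Qed.

Definition face_fun n (t : cube n) : cube n.+1 :=
  in_sub (face_row_cube t).

Lemma smooth_face n : smooth (@face_fun n).
Proof.
move=> k U u [oU Hu]; split=> // j l.
case E : (unlift ord_max j) => [i|].
  by apply: (Ck_ext oU _ (Hu i l)) => x Ux /=; rewrite mxE E.
by apply: (Ck_ext oU _ (Ck_cst l U 0)) => x Ux /=; rewrite mxE E.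
Qed.

Definition face_map n : smooth_map (cube n) (cube n.+1) :=
  SmoothMap (@smooth_face n).

Lemma front_face n (t : 'rV[R]_n) : front (face_row t) = t.
Proof. by apply/rowP => j; rewrite !mxE liftK. Qed.

Lemma face_Jset n (t : cube n) : bd (val t) -> Jset n (val (face_fun t)).
Proof.
by move=> bt; split; [exact: face_row_cube|left; rewrite front_face].
Qed.

Lemma Jset_bd n (t : 'rV[R]_n.+1) : Jset n t -> bd t.
Proof.
case=> _ [[j]|]; first by rewrite mxE => H; exists (lift ord_max j).
by move=> H; exists ord_max; right.
Qed.

Definition set_coord n (t : 'rV[R]_n) (j : 'I_n) (a : R) : 'rV[R]_n :=
  \row_k (if k == j then a else t 0 k).

(* When K is a union of faces of the cube and eps <= 1/2, the point
   set_coord t j a below lies in K automatically. *)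
Definition eps_tame n (K : set 'rV[R]_n) (Y : Type) (eps : R) (f : K -> Y)
    : Prop :=
  forall (t s : K) (j : 'I_n) (a : R), a = 0 \/ a = 1 ->
    `|val t 0 j - a| <= eps -> val s = set_coord (val t) j a -> f t = f s.

Definition tame n (K : set 'rV[R]_n) (Y : Type) (f : K -> Y) : Prop :=
  exists eps : R, 0 < eps <= 2^-1 /\ eps_tame eps f.

End Cubes.
Arguments cube R n : clear implicits.
Arguments Lset R n : clear implicits.
Arguments Jset R n : clear implicits.
Arguments face_map R n : clear implicits.

Definition weak_fibration (R : realType) (E B : diffeologicalType R)
    (p : smooth_map E B) : Prop :=
  forall n (f : smooth_map (Lset R n) E) (g : smooth_map (cube R n.+1) B),
    tame f -> tame g -> (forall x, p (f x) = g (L_incl x)) ->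
  exists G : smooth_map (cube R n.+1) E,
    (forall x, G (L_incl x) = f x) /\ (forall t, p (G t) = g t).

(* The set of classes {y | r x y} of a relation r. It is only used for smooth
   homotopy relations, which are equivalence relations, so that maps given on
   representatives may be evaluated on the representative chosen by repr_of. *)
Section Quotient.
Variables (T : Type) (r : T -> set T).

Definition quot : Type := range r.
Definition class_of (x : T) : quot := in_sub (imageT r x).
Definition repr_of (c : quot) : T := sval (cid2 (set_valP c)).
End Quotient.

Section HomotopySets.
Context {R : realType}.
Implicit Types X Y : diffeologicalType R.

Definition path_related X (x y : X) : Prop :=
  exists c : smooth_map (cube R 1) X, c (cube0 R 1) = x /\ c (cube1 R 1) = y.

Definition loops n X (x0 : X) : set (smooth_map (cube R n) X) :=
  [set f | forall t, bd (val t) -> f t = x0].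
Arguments loops n {X} x0 _.

Definition homotopic n X (x0 : X) (f g : loops n x0) : Prop :=
  exists H : smooth_map (cube R n * cube R 1)%type X,
    [/\ forall t, H (t, cube0 R 1) = val f t,
        forall t, H (t, cube1 R 1) = val g t
      & forall t s, bd (val t) -> H (t, s) = x0].

(* pi_n(X, x0); for n = 0, the set of smooth path components of X *)
Definition hpi n X (x0 : X) : Type :=
  if n is k.+1 then quot (@homotopic k.+1 X x0) else quot (@path_related X).
Arguments hpi n {X} x0.

Lemma loops_cst n X (x0 : X) : loops n x0 (cst_map _ x0).
Proof. by []. Qed.
Definition const_loop n X (x0 : X) : loops n x0 := in_sub (@loops_cst n X x0).
Arguments const_loop n {X} x0.

Definition hpi_base n X (x0 : X) : hpi n x0 :=
  if n is k.+1 then class_of (@homotopic k.+1 X x0) (const_loop k.+1 x0)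
  else class_of (@path_related X) x0.
Arguments hpi_base n {X} x0.

Lemma loops_comp n X Y (phi : smooth_map X Y) (x0 : X) (y0 : Y)
  (h : phi x0 = y0) (f : loops n x0) : loops n y0 (comp_map phi (val f)).
Proof. by move=> t bt /=; rewrite (set_valP f t bt). Qed.

Definition loop_map n X Y (phi : smooth_map X Y) (x0 : X) (y0 : Y)
    (h : phi x0 = y0) (f : loops n x0) : loops n y0 :=
  in_sub (loops_comp h f).

Definition hpi_map n X Y (phi : smooth_map X Y) (x0 : X) (y0 : Y)
    (h : phi x0 = y0) : hpi n x0 -> hpi n y0 :=
  match n return hpi n x0 -> hpi n y0 with
  | 0 => fun c => class_of (@path_related Y) (phi (repr_of c))
  | k.+1 => fun c => class_of (@homotopic k.+1 Y y0) (loop_map h (repr_of c))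
  end.

(* Smooth maps of triples (I^n.+1, bd I^n.+1, J^n) -> (X, A, a). *)
Definition rel_loops n X (A : set X) (a : A)
    : set (smooth_map (cube R n.+1) X) :=
  [set f | (forall t, bd (val t) -> A (f t)) /\
           (forall t, Jset R n (val t) -> f t = val a)].
Arguments rel_loops n {X A} a _.

Definition rel_homotopic n X (A : set X) (a : A) (f g : rel_loops n a) : Prop :=
  exists H : smooth_map (cube R n.+1 * cube R 1)%type X,
    [/\ forall t, H (t, cube0 R 1) = val f t,
        forall t, H (t, cube1 R 1) = val g t,
        forall t s, bd (val t) -> A (H (t, s))
      & forall t s, Jset R n (val t) -> H (t, s) = val a].

(* Beware of the shift: this is pi_(n+1)(X, A, a). *)
Definition rel_hpi n X (A : set X) (a : A) : Type :=
  quot (@rel_homotopic n X A a).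
Arguments rel_hpi n {X A} a.

Lemma face_in n X (A : set X) (a : A) (f : rel_loops n a) (t : cube R n) :
  A (comp_map (val f) (face_map R n) t).
Proof.
apply: (set_valP f).1; exists ord_max; left.
by rewrite mxE unlift_none.
Qed.

Definition restrict_face n X (A : set X) (a : A) (f : rel_loops n a)
    : smooth_map (cube R n) A :=
  corestr_map (face_in f).

Lemma restrict_face_loops n X (A : set X) (a : A) (f : rel_loops n a) :
  loops n a (restrict_face f).
Proof.
by move=> t bt; apply/val_inj/(set_valP f).2/face_Jset.
Qed.

Definition boundary_loop n X (A : set X) (a : A) (f : rel_loops n a)
    : loops n a :=
  in_sub (restrict_face_loops f).

(* The boundary map pi_(n+1)(X, A, a) -> pi_n(A, a); for n = 0 the face I^0 * {0}
   is a point, whose image in A determines a path component. *)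
Definition boundary n X (A : set X) (a : A) : rel_hpi n a -> hpi n a :=
  match n return rel_hpi n a -> hpi n a with
  | 0 => fun c =>
      class_of (@path_related A) (restrict_face (repr_of c) (cube0 R 0))
  | k.+1 => fun c =>
      class_of (@homotopic k.+1 A a) (boundary_loop (repr_of c))
  end.

Definition fiber X Y (p : smooth_map X Y) (y : Y) : set X := p @^-1` [set y].

Lemma fiber_eq X Y (p : smooth_map X Y) (y : Y) (x : fiber p y) :
  p (incl_map (fiber p y) x) = y.
Proof. exact: (set_valP x). Qed.

Lemma rel_loops_comp n X Y (p : smooth_map X Y) (y : Y) (x : fiber p y)
  (f : rel_loops n x) : loops n.+1 y (comp_map p (val f)).
Proof. exact: (set_valP f).1. Qed.

(* The map p_* : pi_(n+1)(X, F, x) -> pi_(n+1)(Y, y, y) = pi_(n+1)(Y, y) *)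
Definition fiber_hpi_map n X Y (p : smooth_map X Y) (y : Y) (x : fiber p y)
    (c : rel_hpi n x) : hpi n.+1 y :=
  class_of (@homotopic n.+1 Y y)
    (in_sub (rel_loops_comp (repr_of c))).

End HomotopySets.

Definition exact_at (T S U : Type) (f : T -> S) (g : S -> U) (u0 : U) : Prop :=
  range f = g @^-1` [set u0].

(* Main.v *)
Require Import Defs.
From mathcomp Require Import all_boot all_order all_algebra.
From mathcomp Require Import boolp classical_sets functions reals topology.
From mathcomp Require Import normedtype derive sequences realfun exp.
From mathcomp Require Import ring lra.

Set Implicit Arguments.
Unset Strict Implicit.
Unset Printing Implicit Defensive.
Import Order.TTheory GRing.Theory Num.Theory.
Import numFieldNormedType.Exports.
Local Open Scope classical_set_scope.
Local Open Scope ring_scope.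

(** The maps of the sequence are handled on representatives.  Two devices make
    the classical proof work for smooth maps.

    First, smooth maps can be glued when they agree on an overlap
    ([smooth_glue]); homotopies are therefore concatenated after slowing down
    their time near the ends by a smooth step function, built from
    [exp(-1/x)].  Second, a map composed with the step function in each
    coordinate ([flat]) is tame, and composition with [flat] does not change
    homotopy classes, because [flat] preserves all faces and the cube is convex
    ([homotopic_reparam]).  Hence lifting problems that are not tame can still
    be solved in a weak fibration, up to this reparametrization ([lift_flat]).

    Lifting loops of the base, with constant values on [J], and lifting
    homotopies of such loops, relative to their ends and to [J], show that the
    projection from [pi_(n+1)(E, F, e)] to [pi_(n+1)(B, b)] is surjective
    ([fiber_hpi_map_surj]) and injective ([fiber_hpi_map_inj]); the connecting map
    is the boundary map composed with the inverse of this bijection.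

    Exactness at the fiber is a property of the pair: a null homotopy in [E] of
    a loop of [F] is the same thing as a map of triples bounded by this loop
    ([exact_at_boundary]).  Exactness at the total space is obtained by lifting a
    null homotopy of the projected loop ([exact_at_total]).  Exactness at the
    base is obtained by gluing to a map of triples a null homotopy in [F] of its
    boundary ([exact_base]).

    Maps from the cube of dimension [0] are points, and their homotopies are
    paths, so that the same arguments cover [pi_0] ([hclass]). *)

(** * A smooth step function *)

Section Step.
Context {R : realType}.

(** The classical flat functions: [x^-k * exp(-1/x)] for [x > 0] and [0] for
    [x <= 0].  The whole family in [k] is needed, as it is closed under
    differentiation up to linear combinations. *)
Definition bump k (x : R) : R :=
  if 0 < x then x^-1 ^+ k * expR (- x^-1) else 0.

(** This bound makes [bump k] differentiable at [0], with derivative [0]. *)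
Lemma bump_quadratic k : exists2 C : R, 0 < C & forall x, `|bump k x| <= C * x ^+ 2.
Proof.
(* With [y = 1/x] and [N = k + 2], this is [(y / N)^N <= (exp(y / N))^N = exp y]. *)
exists ((k.+2)%:R ^+ k.+2) => [|x]; first exact: exprn_gt0.
rewrite /bump; case: ifP => x0; last by rewrite normr0 mulr_ge0 ?sqr_ge0 ?exprn_ge0.
rewrite ger0_norm ?mulr_ge0 ?exprn_ge0 ?invr_ge0 ?expR_ge0 ?(ltW x0)//.
have y0 : 0 < x^-1 by rewrite invr_gt0.
have H : (x^-1 / k.+2%:R) ^+ k.+2 <= expR (x^-1).
  have {2}-> : x^-1 = k.+2%:R * (x^-1 / k.+2%:R) :> R.
    by rewrite mulrC divfK // pnatr_eq0.
  rewrite expRM_natl lerXn2r ?nnegrE ?expR_ge0 ?divr_ge0 ?ltW//.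
  by rewrite (lt_le_trans _ (expR_ge1Dx _))// ltrDr.
rewrite expRN ler_pdivrMr ?expR_gt0 //.
have -> : x^-1 ^+ k = (k.+2%:R ^+ k.+2 * x ^+ 2) * (x^-1 / k.+2%:R) ^+ k.+2.
  rewrite exprMn [x^-1 ^+ k.+2 * _]mulrC mulrACA -exprMn divff ?pnatr_eq0//.
  rewrite expr1n mul1r -(addn2 k) exprD mulrCA -exprMn divff ?gt_eqF//.
  by rewrite expr1n mulr1.
by rewrite ler_pM2l // mulr_gt0 ?exprn_gt0.
Qed.

Lemma is_derive_bump k (x : R) :
  is_derive x 1 (bump k) (bump k.+2 x - k%:R * bump k.+1 x).
Proof.
have [x0|x0|x0] := ltgtP x 0.
- rewrite {2 3}/bump ltNge (ltW x0) /= mulr0 subr0.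
  apply: (@near_eq_is_derive _ _ _ (cst 0)) => //.
  near=> y; rewrite /bump ltNge ltW //=.
  by near: y; exact: lt_nbhsl.
- have xn0 : x != 0 by rewrite gt_eqF.
  apply: (@near_eq_is_derive _ _ _ (fun y : R => y^-1 ^+ k * expR (- y^-1))) => //.
    near=> y; rewrite /bump ifT //; near: y; exact: lt_nbhsr.
  rewrite /bump x0.
  pose hh := fun y : R => y^-1.
  have dh : is_derive x 1 hh (- (x ^- 2)).
    by apply: is_derive_eq; [exact: (@is_deriveV R id)|rewrite /GRing.scale/= mulr1].
  have de : is_derive x 1 (expR \o (- hh)) (expR (- hh x) * (x ^- 2)).
    by rewrite -[x ^- 2]opprK; apply: is_derive1_comp.
  have dk : is_derive x 1 (hh ^+ k) ((k%:R * hh x ^+ k.-1) *: (- x ^- 2)).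
    exact: is_deriveX.
  have H := is_deriveM dk de.
  rewrite (_ : (fun y => _) = hh ^+ k * (expR \o - hh)); last first.
    by apply/funext => y; rewrite /= mulrfctE exprfctE.
  apply: is_derive_eq H _; rewrite exprfctE /GRing.scale /= opprfctE /hh.
  move: (expR _) => v; rewrite -!exprVn; move: (x^-1) => w.
  by case: k {dk} => [|k] /=; rewrite ?exprS; ring.
- rewrite x0 {2 3}/bump ltxx mulr0 subr0.
  have [C C0 HC] := bump_quadratic k.
  have cv : (fun h => h^-1 *: (bump k (h *: 1 + 0) - bump k 0)) @ (0 : R)^' --> (0 : R).
    apply/cvgr0Pnorm_le => /= eps eps0; near=> h.
    have h0 : h != 0 by near: h; exact: nbhs_dnbhs_neq.
    rewrite {2}/bump ltxx subr0 addr0 /GRing.scale /= mulr1 normrM normfV.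
    rewrite ler_pdivrMl ?normr_gt0 // (le_trans (HC h)) //.
    rewrite -real_normK ?num_real // expr2 mulrCA ler_pM2l ?normr_gt0 //.
    rewrite mulrC -ler_pdivlMr //.
    by near: h; apply: dnbhs0_le; exact: divr_gt0.
  by apply: DeriveDef; [exact: cvgP cv|exact: cvg_lim cv].
Unshelve. all: by end_near. Qed.
End Step.

Section SmoothStep.
Context {R : realType}.

Lemma bump_ge0 k (x : R) : 0 <= bump k x.
Proof.
rewrite /bump; case: ifP => // x0.
by rewrite mulr_ge0 ?expR_ge0 // exprn_ge0 // invr_ge0 ltW.
Qed.

Lemma bump_gt0 k (x : R) : 0 < x -> 0 < bump k x.
Proof. by move=> x0; rewrite /bump x0 mulr_gt0 ?expR_gt0 ?exprn_gt0 ?invr_gt0. Qed.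

Lemma bump_eq0 k (x : R) : x <= 0 -> bump k x = 0.
Proof. by rewrite /bump leNgt => /negbTE ->. Qed.

Lemma derive_scalar_comp n (g : R -> R) (f : 'rV[R]_n -> R) x v d :
  is_derive (f x) 1 g d -> differentiable f x ->
  differentiable (g \o f) x /\ 'D_v (g \o f) x = d * 'D_v f x.
Proof.
move=> [dg gd] df; have dg' := (derivable1_diffP g (f x)).1 dg.
have dgf : differentiable (g \o f) x by exact: differentiable_comp.
split=> //; rewrite !deriveE // diff_comp //= diff1E //.
by rewrite derive1E gd mulrC.
Qed.

Lemma Ck_bump k n (U : set 'rV[R]_n) f j : open U ->
  Ck k U f -> Ck k U (bump j \o f).
Proof.
move=> oU; elim: k f j => [|k IH] f j Hf.
  move=> x Ux; apply: continuous_comp; first exact: Hf.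
  have [db _] := is_derive_bump j (f x).
  exact/differentiable_continuous/derivable1_diffP.
have [f1 f2] := Hf; split=> [x Ux|v].
  exact: (derive_scalar_comp 0 (is_derive_bump j (f x)) (f1 x Ux)).1.
have H := CkM oU (CkD oU (IH _ j.+2 (Ck_le Hf)) (CkM oU (Ck_cst k U (- j%:R))
  (IH _ j.+1 (Ck_le Hf)))) (f2 v).
apply: (Ck_ext oU _ H) => x Ux.
rewrite (derive_scalar_comp v (is_derive_bump j (f x)) (f1 x Ux)).2.
by rewrite /= mulNr.
Qed.

Lemma Ck_inv k n (U : set 'rV[R]_n) (f : 'rV[R]_n -> R) :
  open U -> (forall x, U x -> f x != 0) ->
  Ck k U f -> Ck k U (fun x => (f x)^-1).
Proof.
move=> oU f0; elim: k => [|k IH] Hf.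
  by move=> x Ux; exact: (cvgV (f0 x Ux) (Hf x Ux)).
have [f1 f2] := Hf; split=> [x Ux|v].
  exact: (differentiableV (f1 x Ux) (f0 x Ux)).
have Hi := IH (Ck_le Hf).
apply: (Ck_ext oU _ (CkM oU (CkM oU (Ck_cst k U (-1)) (CkM oU Hi Hi)) (f2 v))).
move=> x Ux; rewrite (deriveV (f0 x Ux) (diff_derivable (f1 x Ux))).
by rewrite /GRing.scale /= mulN1r -expr2 exprVn.
Qed.

(** A smooth function with values in [[0, 1]], equal to [0] on [x <= 1/4] and to
    [1] on [x >= 3/4]. *)
Definition step (x : R) : R :=
  bump 0 (x - 4^-1) / (bump 0 (x - 4^-1) + bump 0 (3 / 4 - x)).

Lemma step_den_gt0 (x : R) : 0 < bump 0 (x - 4^-1) + bump 0 (3 / 4 - x).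
Proof.
have [x2|x2] := leP (2^-1) x.
- by rewrite ltr_wpDr ?bump_ge0 ?bump_gt0 //; lra.
- by rewrite ltr_wpDl ?bump_ge0 ?bump_gt0 //; lra.
Qed.

Lemma Ck_step k n (U : set 'rV[R]_n) f : open U ->
  Ck k U f -> Ck k U (step \o f).
Proof.
move=> oU Hf.
have N1 := CkM oU (Ck_cst k U (-1)) Hf.
have A := Ck_bump 0 oU (CkD oU Hf (Ck_cst k U (- 4^-1))).
have B := Ck_bump 0 oU (CkD oU (Ck_cst k U (3 / 4)) N1).
have D := Ck_inv oU _ (CkD oU A B).
apply: (Ck_ext oU _ (CkM oU A (D _))) => x Ux; rewrite /= mulN1r //.
by rewrite gt_eqF // step_den_gt0.
Qed.

Lemma step_itv x : 0 <= step x <= 1.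
Proof.
rewrite divr_ge0 ?bump_ge0 ?(ltW (step_den_gt0 x)) //=.
by rewrite ler_pdivrMr ?step_den_gt0 // mul1r lerDl bump_ge0.
Qed.

Lemma step_eq0 x : x <= 4^-1 -> step x = 0.
Proof. by move=> x4; rewrite /step bump_eq0 ?mul0r // subr_le0. Qed.

Lemma step_eq1 x : 3 / 4 <= x -> step x = 1.
Proof.
move=> x4; have := step_den_gt0 x.
by rewrite /step [bump 0 (3 / 4 - x)]bump_eq0 ?subr_le0 // addr0 => ?;
  rewrite divff // gt_eqF.
Qed.

End SmoothStep.

(** * Smooth real functions and gluing in diffeological spaces *)

Section RealSmooth.
Context {R : realType}.
Implicit Types X Y Z : diffeologicalType R.

Lemma smooth_map_eq X Y (f g : smooth_map X Y) : f =1 g -> f = g.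
Proof.
case: f g => [f Hf] [g Hg] /= /funext E; case: _ / E Hg => Hg.
by rewrite (Prop_irrelevance Hf Hg).
Qed.

(** Smoothness of a real-valued function on a diffeological space, tested on
    plots; a map into a subset of [R^n] is smooth as soon as its coordinates
    are ([smooth_to_set]). *)
Definition real_smooth X (f : X -> R) : Prop :=
  forall n (U : set 'rV[R]_n) (u : 'rV[R]_n -> X), plot U u -> Cinfty U (f \o u).

Lemma real_smooth_cst X (c : R) : real_smooth (fun _ : X => c).
Proof. by move=> n U u _ k; exact: Ck_cst. Qed.

Lemma real_smoothD X (f g : X -> R) :
  real_smooth f -> real_smooth g -> real_smooth (fun x => f x + g x).
Proof.
by move=> Hf Hg n U u pu k; apply: (CkD (plot_open pu) (Hf _ _ _ pu k) (Hg _ _ _ pu k)).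
Qed.

Lemma real_smoothM X (f g : X -> R) :
  real_smooth f -> real_smooth g -> real_smooth (fun x => f x * g x).
Proof.
by move=> Hf Hg n U u pu k; apply: (CkM (plot_open pu) (Hf _ _ _ pu k) (Hg _ _ _ pu k)).
Qed.

Lemma real_smooth_eq X (f g : X -> R) : f =1 g -> real_smooth f -> real_smooth g.
Proof. by move=> /funext ->. Qed.

Lemma real_smoothN X (f : X -> R) : real_smooth f -> real_smooth (fun x => - f x).
Proof.
move=> Hf; apply: (real_smooth_eq _ (real_smoothM (real_smooth_cst (-1)) Hf)) => x.
by rewrite mulN1r.
Qed.

Lemma real_smoothB X (f g : X -> R) :
  real_smooth f -> real_smooth g -> real_smooth (fun x => f x - g x).
Proof. by move=> Hf Hg; exact: real_smoothD Hf (real_smoothN Hg). Qed.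

Lemma real_smooth_step X (f : X -> R) :
  real_smooth f -> real_smooth (fun x => step (f x)).
Proof.
by move=> Hf n U u pu k; apply: (Ck_step (plot_open pu) (Hf _ _ _ pu k)).
Qed.

Lemma real_smooth_comp X Y (g : smooth_map X Y) (f : Y -> R) :
  real_smooth f -> real_smooth (fun x => f (g x)).
Proof. by move=> Hf n U u /(smooth_funP g) /Hf. Qed.

Lemma real_smooth_coord n (A : set 'rV[R]_n) j :
  real_smooth (fun x : A => val x 0 j).
Proof. by move=> m U u [oU Hu]; exact: Hu. Qed.

Lemma smooth_to_set X n (A : set 'rV[R]_n) (phi : X -> 'rV[R]_n)
    (phiA : forall x, A (phi x)) :
  (forall j, real_smooth (fun x => phi x 0 j)) ->
  smooth (fun x => in_sub (phiA x) : A).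
Proof.
move=> Hphi m U u pu; split; first exact: plot_open pu.
by move=> j; exact: Hphi.
Qed.

Definition to_set X n (A : set 'rV[R]_n) (phi : X -> 'rV[R]_n)
    (phiA : forall x, A (phi x))
    (sphi : forall j, real_smooth (fun x => phi x 0 j)) : smooth_map X A :=
  SmoothMap (smooth_to_set phiA sphi).

Lemma smooth_pair X Y Z (f : smooth_map X Y) (g : smooth_map X Z) :
  smooth (fun x => (f x, g x)).
Proof.
by move=> n U u pu; split; [exact: (smooth_funP f)|exact: (smooth_funP g)].
Qed.
Definition pair_map X Y Z (f : smooth_map X Y) (g : smooth_map X Z) :
  smooth_map X (Y * Z)%type := SmoothMap (smooth_pair f g).

Lemma smooth_fst X Y : smooth (fst : X * Y -> X).
Proof. by move=> n U u []. Qed.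
Definition fst_map X Y : smooth_map (X * Y)%type X := SmoothMap (@smooth_fst X Y).

Lemma smooth_snd X Y : smooth (snd : X * Y -> Y).
Proof. by move=> n U u []. Qed.
Definition snd_map X Y : smooth_map (X * Y)%type Y := SmoothMap (@smooth_snd X Y).

Lemma plot_sub X n (U V : set 'rV[R]_n) (u : 'rV[R]_n -> X) :
  open V -> V `<=` U -> plot U u -> plot V u.
Proof.
move=> oV VU pu.
have Hid j : Cinfty V (fun x => (id x : 'rV[R]_n) 0 j).
  by move=> k; exact: Ck_coord.
exact: (plot_comp (h := id) oV VU Hid pu).
Qed.

Lemma open_lt_plot X n (U : set 'rV[R]_n) (u : 'rV[R]_n -> X) (r : X -> R) c :
  real_smooth r -> plot U u -> open [set x | U x /\ r (u x) < c].
Proof.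
move=> Hr pu; have oU := plot_open pu; rewrite openE => x [Ux rx].
have Cr : {for x, continuous (r \o u)} := Hr _ _ _ pu 0 x Ux.
rewrite /interior; near=> y; split.
  by near: y; exact: open_nbhs_nbhs.
by near: y; exact: (Cr _ (lt_nbhsl rx)).
Unshelve. all: by end_near. Qed.

(** Two smooth maps that agree where a smooth function [r] takes values strictly
    between [a] and [b] can be glued along a level [c] of [r] in between: the
    sets [r < b] and [r > a] form an open cover, and the glued map coincides
    with one of the two maps on each of them. *)
Lemma smooth_glue X Y (f0 f1 : smooth_map X Y) (r : X -> R) (a b c : R) :
  real_smooth r -> a < c < b -> (forall x, a < r x < b -> f0 x = f1 x) ->
  smooth (fun x => if r x < c then f0 x else f1 x).
Proof.
move=> Hr /andP[ac cb] f01 n U u pu; have oU := plot_open pu.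
apply: plot_local => // x Ux; have [rx|rx] := ltP (r (u x)) b.
- exists [set x | U x /\ r (u x) < b]; split=> //; first by move=> y [].
  apply: (@plot_ext _ _ _ _ (f0 \o u)) => [y [Uy ry] /=|].
    by case: ltP => // cr; rewrite f01 // ry (lt_le_trans ac).
  by apply: plot_sub (smooth_funP f0 pu); [exact: open_lt_plot|move=> y []].
- exists [set x | U x /\ - r (u x) < - a]; split=> //.
  + by split=> //; rewrite ltrN2 (lt_le_trans _ rx) ?(lt_trans ac).
  + by move=> y [].
  apply: (@plot_ext _ _ _ _ (f1 \o u)) => [y [Uy] /=|].
    by rewrite ltrN2 => ry; case: ltP => // cr; rewrite f01 // ry (lt_trans cr).
  apply: plot_sub (smooth_funP f1 pu); last by move=> y [].
  by apply: (@open_lt_plot _ _ _ _ (fun x => - r x)) => //; exact: real_smoothN.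
Qed.

End RealSmooth.

(** * Cubes as products *)

Section CubeMaps.
Context {R : realType}.
Implicit Types X Y Z : diffeologicalType R.

(** The point [(t, s)] of [R^n * R], as a point of [R^(n+1)]; it is inverse to
    [t |-> (front t, t 0 ord_max)]. *)
Definition join n (t : 'rV[R]_n) (s : R) : 'rV[R]_n.+1 :=
  \row_j (if unlift ord_max j is Some i then t 0 i else s).

Lemma join_lift n (t : 'rV[R]_n) s i : join t s 0 (lift ord_max i) = t 0 i.
Proof. by rewrite mxE liftK. Qed.

Lemma join_last n (t : 'rV[R]_n) s : join t s 0 ord_max = s.
Proof. by rewrite mxE unlift_none. Qed.

Lemma front_join n (t : 'rV[R]_n) s : front (join t s) = t.
Proof. by apply/rowP => j; rewrite mxE join_lift. Qed.

Lemma join_front n (t : 'rV[R]_n.+1) : join (front t) (t 0 ord_max) = t.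
Proof.
by apply/rowP => j; rewrite mxE; case: unliftP => [i|] ->; rewrite ?mxE.
Qed.

Lemma cube_join n (t : 'rV[R]_n) s : cube R n t -> 0 <= s <= 1 ->
  cube R n.+1 (join t s).
Proof. by move=> Ht Hs j; rewrite mxE; case: unliftP. Qed.

Lemma cube_front n (t : 'rV[R]_n.+1) : cube R n.+1 t -> cube R n (front t).
Proof. by move=> Ht j; rewrite mxE; exact: Ht. Qed.

Lemma cube_itv n (t : cube R n) j : 0 <= val t 0 j <= 1.
Proof. exact: (set_valP t). Qed.

Lemma real_smooth_join X n (phi : X -> 'rV[R]_n) (s : X -> R) :
  (forall j, real_smooth (fun x => phi x 0 j)) -> real_smooth s ->
  forall j, real_smooth (fun x => join (phi x) (s x) 0 j).
Proof.
move=> Hphi Hs j; case: (unliftP ord_max j) => [i|] ->.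
  by apply: (real_smooth_eq _ (Hphi i)) => x; rewrite join_lift.
by apply: (real_smooth_eq _ Hs) => x; rewrite join_last.
Qed.

Lemma bd_join n (t : 'rV[R]_n) s : bd (join t s) <-> [\/ bd t, s = 0 | s = 1].
Proof.
split.
  case=> j; case: (unliftP ord_max j) => [i|] ->.
    by rewrite join_lift => H; constructor 1; exists i.
  by rewrite join_last => -[]; [constructor 2|constructor 3].
case=> [[j H]|H|H].
- by exists (lift ord_max j); rewrite join_lift.
- by exists ord_max; rewrite join_last; left.
- by exists ord_max; rewrite join_last; right.
Qed.

Lemma cube1_eq (s t : cube R 1) : val s 0 0 = val t 0 0 -> s = t.
Proof. by move=> st; apply/val_inj/rowP => j; rewrite (ord1 j). Qed.

(** A smooth function with values in [[0, 1]], as a map to [cube R 1]. *)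
Definition to_I X (s : X -> R) (sI : forall x, 0 <= s x <= 1)
    (ss : real_smooth s) : smooth_map X (cube R 1) :=
  to_set (fun x => @cube_cst R 1 _ (sI x))
    (fun j => real_smooth_eq (fun x => esym (mxE _ _ 0 j)) ss).

Lemma to_IE X (s : X -> R) sI ss x : val (@to_I X s sI ss x) 0 0 = s x.
Proof. by rewrite mxE. Qed.
End CubeMaps.

Arguments loops {R} n {X} x0 _.
Arguments rel_loops {R} n {X A} a _.

(** * Homotopies: concatenation and reparametrization *)

Section Homotopies.
Context {R : realType}.
Implicit Types X Y Z : diffeologicalType R.

Lemma real_smooth_I X (f : smooth_map X (cube R 1)) :
  real_smooth (fun x => val (f x) 0 0).
Proof. exact: (real_smooth_comp f (@real_smooth_coord _ _ _ 0)). Qed.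

Lemma rev_itv (s : cube R 1) : 0 <= 1 - val s 0 0 <= 1.
Proof. by have := cube_itv s 0; lra. Qed.

(** [s |-> 1 - s] *)
Definition rev_I : smooth_map (cube R 1) (cube R 1) :=
  to_I rev_itv (real_smoothB (real_smooth_cst 1) (@real_smooth_coord _ _ _ 0)).

Lemma rev_I0 : rev_I (cube0 R 1) = cube1 R 1.
Proof. by apply: cube1_eq; rewrite to_IE !mxE subr0. Qed.

Lemma rev_I1 : rev_I (cube1 R 1) = cube0 R 1.
Proof. by apply: cube1_eq; rewrite to_IE !mxE subrr. Qed.

(** [lo_I] and [hi_I] run through the interval during the first and the second
    half of the time, and are constant near the middle [s = 1/2], so that the
    concatenation of two homotopies is smooth. *)
Definition lo_I : smooth_map (cube R 1) (cube R 1) :=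
  to_I (fun s : cube R 1 => step_itv (2 * val s 0 0))
    (real_smooth_step (real_smoothM (real_smooth_cst 2)
      (@real_smooth_coord _ _ _ 0))).

Definition hi_I : smooth_map (cube R 1) (cube R 1) :=
  to_I (fun s : cube R 1 => step_itv (2 * val s 0 0 - 1))
    (real_smooth_step (real_smoothB (real_smoothM (real_smooth_cst 2)
      (@real_smooth_coord _ _ _ 0)) (real_smooth_cst 1))).

Lemma lo_I0 : lo_I (cube0 R 1) = cube0 R 1.
Proof. by apply: cube1_eq; rewrite to_IE !mxE step_eq0 //; lra. Qed.

Lemma lo_I1 (s : cube R 1) : 3 / 8 <= val s 0 0 -> lo_I s = cube1 R 1.
Proof. by move=> Hs; apply: cube1_eq; rewrite to_IE !mxE step_eq1 //; lra. Qed.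

Lemma hi_I0 (s : cube R 1) : val s 0 0 <= 5 / 8 -> hi_I s = cube0 R 1.
Proof. by move=> Hs; apply: cube1_eq; rewrite to_IE !mxE step_eq0 //; lra. Qed.

Lemma hi_I1 : hi_I (cube1 R 1) = cube1 R 1.
Proof. by apply: cube1_eq; rewrite to_IE !mxE step_eq1 //; lra. Qed.

(** The reparametrization [(z, s) |-> (z, a s)] of the time of a homotopy. *)
Definition time_map Z (a : smooth_map (cube R 1) (cube R 1)) :
    smooth_map (Z * cube R 1)%type (Z * cube R 1)%type :=
  pair_map (fst_map _ _) (comp_map a (snd_map _ _)).

Arguments time_map {Z} a.

Lemma comp_time_map Z X (H : smooth_map (Z * cube R 1)%type X) a z s :
  comp_map H (time_map a) (z, s) = H (z, a s).
Proof. by []. Qed.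

Lemma smooth_concat Z X (H1 H2 : smooth_map (Z * cube R 1)%type X) :
  (forall z, H1 (z, cube1 R 1) = H2 (z, cube0 R 1)) ->
  smooth (fun zs : Z * cube R 1 => if val zs.2 0 0 < 2^-1
     then H1 (time_map lo_I zs) else H2 (time_map hi_I zs)).
Proof.
move=> H12.
apply: (@smooth_glue _ _ _ (comp_map H1 (time_map lo_I))
  (comp_map H2 (time_map hi_I)) (fun zs => val zs.2 0 0) (3 / 8) (5 / 8)).
- exact: (real_smooth_I (snd_map Z (cube R 1))).
- lra.
- move=> [z s] /andP[s1 s2]; change (H1 (z, lo_I s) = H2 (z, hi_I s)).
  rewrite lo_I1 ?ltW // hi_I0 ?ltW //; exact: H12.
Qed.

(** The concatenation of two homotopies. *)
Definition concat Z X (H1 H2 : smooth_map (Z * cube R 1)%type X)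
    (H12 : forall z, H1 (z, cube1 R 1) = H2 (z, cube0 R 1)) :
    smooth_map (Z * cube R 1)%type X :=
  SmoothMap (smooth_concat H12).

Section ConcatValues.
Variables (Z X : diffeologicalType R) (H1 H2 : smooth_map (Z * cube R 1)%type X).
Variable H12 : forall z, H1 (z, cube1 R 1) = H2 (z, cube0 R 1).

Lemma concatE z s : concat H12 (z, s) =
  if val s 0 0 < 2^-1 then H1 (z, lo_I s) else H2 (z, hi_I s).
Proof. by []. Qed.

Lemma concat0 z : concat H12 (z, cube0 R 1) = H1 (z, cube0 R 1).
Proof. by rewrite concatE lo_I0 mxE invr_gt0 ltr0n. Qed.

Lemma concat1 z : concat H12 (z, cube1 R 1) = H2 (z, cube1 R 1).
Proof.
by rewrite concatE hi_I1 mxE ifF //; apply/negbTE; rewrite -leNgt; lra.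
Qed.

Lemma concat_inv (P : Z -> X -> Prop) z s :
  (forall s, P z (H1 (z, s))) -> (forall s, P z (H2 (z, s))) ->
  P z (concat H12 (z, s)).
Proof. by move=> P1 P2; rewrite concatE; case: ifP => _; [exact: P1|exact: P2]. Qed.
End ConcatValues.

Lemma homotopic_refl n X (x0 : X) (f : loops n x0) : homotopic f f.
Proof.
exists (comp_map (val f) (fst_map _ _)); split=> // t s bt.
exact: (set_valP f).
Qed.

Lemma homotopic_sym n X (x0 : X) (f g : loops n x0) :
  homotopic f g -> homotopic g f.
Proof.
case=> H [H0 H1 Hb]; exists (comp_map H (time_map rev_I)); split=> [t|t|t s bt]; rewrite comp_time_map.
- by rewrite rev_I0 H1.
- by rewrite rev_I1 H0.
- exact: Hb.
Qed.

Lemma homotopic_trans n X (x0 : X) (f g h : loops n x0) :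
  homotopic f g -> homotopic g h -> homotopic f h.
Proof.
case=> H [H0 H1 Hb] [K [K0 K1 Kb]].
have HK t : H (t, cube1 R 1) = K (t, cube0 R 1) by rewrite H1 K0.
exists (concat HK); split=> [t|t|t s bt].
- by rewrite concat0 H0.
- by rewrite concat1 K1.
- by apply: (concat_inv HK (P := fun _ x => x = x0)) => s'; [exact: Hb|exact: Kb].
Qed.

Lemma rel_homotopic_refl n X (A : set X) (a : A) (f : rel_loops n a) :
  rel_homotopic f f.
Proof.
exists (comp_map (val f) (fst_map _ _)); split=> // t s Ht.
- exact: (set_valP f).1.
- exact: (set_valP f).2.
Qed.

Lemma rel_homotopic_sym n X (A : set X) (a : A) (f g : rel_loops n a) :
  rel_homotopic f g -> rel_homotopic g f.
Proof.
case=> H [H0 H1 Hb HJ]; exists (comp_map H (time_map rev_I)).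
split=> [t|t|t s bt|t s Jt]; rewrite comp_time_map.
- by rewrite rev_I0 H1.
- by rewrite rev_I1 H0.
- exact: Hb.
- exact: HJ.
Qed.

Lemma rel_homotopic_trans n X (A : set X) (a : A) (f g h : rel_loops n a) :
  rel_homotopic f g -> rel_homotopic g h -> rel_homotopic f h.
Proof.
case=> H [H0 H1 Hb HJ] [K [K0 K1 Kb KJ]].
have HK t : H (t, cube1 R 1) = K (t, cube0 R 1) by rewrite H1 K0.
exists (concat HK); split=> [t|t|t s bt|t s Jt].
- by rewrite concat0 H0.
- by rewrite concat1 K1.
- by apply: (concat_inv HK (P := fun _ => A)) => s'; [exact: Hb|exact: Kb].
- by apply: (concat_inv HK (P := fun _ x => x = val a)) => s'; [exact: HJ|exact: KJ].
Qed.

(** A self-map of the cube that maps every face to itself.  It is homotopic to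
    the identity through such maps, by convexity ([blend]); hence composing with
    it does not change absolute or relative homotopy classes
    ([homotopic_reparam], [rel_homotopic_reparam]). *)
Definition face_preserving n (psi : cube R n -> cube R n) : Prop :=
  forall (t : cube R n) j a, a = 0 \/ a = 1 -> val t 0 j = a -> val (psi t) 0 j = a.

Lemma blend_cube n (psi : smooth_map (cube R n) (cube R n))
    (ts : cube R n * cube R 1) :
  cube R n (\row_j ((1 - val ts.2 0 0) * val ts.1 0 j
                    + val ts.2 0 0 * val (psi ts.1) 0 j)).
Proof.
move=> j; rewrite mxE; have := cube_itv ts.2 0; have := cube_itv ts.1 j.
by have := cube_itv (psi ts.1) j; nra.
Qed.

Lemma blend_smooth n (psi : smooth_map (cube R n) (cube R n)) j :
  real_smooth (fun ts : cube R n * cube R 1 =>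
    (\row_j ((1 - val ts.2 0 0) * val ts.1 0 j
                    + val ts.2 0 0 * val (psi ts.1) 0 j)) 0 j).
Proof.
have S := real_smooth_I (snd_map (cube R n) (cube R 1)).
have T := real_smooth_comp (fst_map _ (cube R 1)) (@real_smooth_coord _ _ (cube R n) j).
have P := real_smooth_comp (comp_map psi (fst_map _ (cube R 1)))
  (@real_smooth_coord _ _ (cube R n) j).
apply: (real_smooth_eq _ (real_smoothD (real_smoothM
  (real_smoothB (real_smooth_cst 1) S) T) (real_smoothM S P))) => ts.
by rewrite mxE.
Qed.

(** The straight-line homotopy [(t, s) |-> (1 - s) t + s psi(t)]. *)
Definition blend n (psi : smooth_map (cube R n) (cube R n)) :
    smooth_map (cube R n * cube R 1)%type (cube R n) :=
  to_set (blend_cube psi) (blend_smooth psi).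

Lemma blend0 n (psi : smooth_map (cube R n) (cube R n)) t :
  blend psi (t, cube0 R 1) = t.
Proof.
by apply/val_inj/rowP => j; rewrite !mxE /= subr0 mul1r mul0r addr0.
Qed.

Lemma blend1 n (psi : smooth_map (cube R n) (cube R n)) t :
  blend psi (t, cube1 R 1) = psi t.
Proof.
by apply/val_inj/rowP => j; rewrite !mxE /= subrr mul0r mul1r add0r.
Qed.

Lemma face_preserving_blend n (psi : smooth_map (cube R n) (cube R n)) s :
  face_preserving psi -> face_preserving (fun t => blend psi (t, s)).
Proof.
by move=> Hpsi t j a Ha tj; rewrite mxE /= tj (Hpsi t j a Ha tj); ring.
Qed.

Lemma face_preserving_bd n (psi : cube R n -> cube R n) (t : cube R n) :
  face_preserving psi -> bd (val t) -> bd (val (psi t)).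
Proof.
move=> Hpsi [j [] tj]; exists j; [left|right].
  by apply: Hpsi tj; left.
by apply: Hpsi tj; right.
Qed.

Lemma face_preserving_Jset n (psi : cube R n.+1 -> cube R n.+1) (t : cube R n.+1) :
  face_preserving psi -> Jset R n (val t) -> Jset R n (val (psi t)).
Proof.
move=> Hpsi [_ Ht]; split; first exact: (set_valP (psi t)).
case: Ht => [[j]|tj]; last by right; apply: Hpsi tj; right.
rewrite mxE => Hj; left; exists j; rewrite mxE.
by case: Hj => tj; [left|right]; apply: Hpsi tj; [left|right].
Qed.

Lemma homotopic_reparam n X (x0 : X) (f g : loops n x0)
    (psi : smooth_map (cube R n) (cube R n)) :
  face_preserving psi -> (forall t, val g t = val f (psi t)) -> homotopic f g.
Proof.
move=> Hpsi fg; exists (comp_map (val f) (blend psi)); split=> [t|t|t s bt].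
- by congr (val f _); exact: blend0.
- by rewrite fg; congr (val f _); exact: blend1.
- apply: (set_valP f).
  exact: (face_preserving_bd (face_preserving_blend s Hpsi) bt).
Qed.

Lemma rel_homotopic_reparam n X (A : set X) (a : A) (f g : rel_loops n a)
    (psi : smooth_map (cube R n.+1) (cube R n.+1)) :
  face_preserving psi -> (forall t, val g t = val f (psi t)) ->
  rel_homotopic f g.
Proof.
move=> Hpsi fg; exists (comp_map (val f) (blend psi)).
split=> [t|t|t s bt|t s Jt].
- by congr (val f _); exact: blend0.
- by rewrite fg; congr (val f _); exact: blend1.
- apply: (set_valP f).1.
  exact: (face_preserving_bd (face_preserving_blend s Hpsi) bt).
- apply: (set_valP f).2.
  exact: (face_preserving_Jset (face_preserving_blend s Hpsi) Jt).
Qed.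

End Homotopies.
Arguments time_map {R Z} a.

(** * Homotopy classes *)

Section Classes.
Context {R : realType}.
Implicit Types X Y Z : diffeologicalType R.

Lemma class_of_eq (T : Type) (r : T -> set T) :
  (forall x, r x x) -> (forall x y, r x y -> r y x) ->
  (forall x y z, r x y -> r y z -> r x z) ->
  forall x y, class_of r x = class_of r y <-> r x y.
Proof.
move=> rr rs rt x y; split=> [/(congr1 val) /= E|rxy].
  by have := rr y; rewrite -E.
apply/val_inj => /=; apply/seteqP; split=> z.
  by apply: rt; exact: rs.
exact: rt.
Qed.

Lemma class_of_repr (T : Type) (r : T -> set T) (c : quot r) :
  class_of r (Defs.repr_of c) = c.
Proof. by apply/val_inj; rewrite /Defs.repr_of; case: cid2 => x _ E /=. Qed.

Lemma cube_dim0 (t : cube R 0) : t = cube0 R 0.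
Proof. by apply/val_inj/rowP => -[]. Qed.

Lemma bd_dim0 (t : 'rV[R]_0) : ~ bd t.
Proof. by case=> -[]. Qed.

Lemma loops_dim0 X (x0 : X) (f : smooth_map (cube R 0) X) : loops 0 x0 f.
Proof. by move=> t /bd_dim0. Qed.

(** A point of [X], as a map from the cube of dimension [0], on which the boundary
    condition is empty. *)
Definition point_loop X (x0 x : X) : loops 0 x0 :=
  in_sub (loops_dim0 x0 (cst_map (cube R 0) x)).

Lemma path_homotopic X (x0 : X) (f g : loops 0 x0) :
  path_related (val f (cube0 R 0)) (val g (cube0 R 0)) <-> homotopic f g.
Proof.
split=> [[c [c0 c1]]|[H [H0 H1 _]]].
  exists (comp_map c (snd_map _ _)); split=> [t|t|t s /bd_dim0 //] /=.
    by rewrite c0 -(cube_dim0 t).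
  by rewrite c1 -(cube_dim0 t).
exists (comp_map H (pair_map (cst_map _ (cube0 R 0)) (to_I
  (fun s : cube R 1 => cube_itv s 0) (@real_smooth_coord _ _ _ 0)))).
split.
- rewrite -H0; congr (H (_, _)); apply: cube1_eq; exact: to_IE.
- rewrite -H1; congr (H (_, _)); apply: cube1_eq; exact: to_IE.
Qed.

Lemma path_related_homotopic X (x y x0 : X) :
  path_related x y <-> homotopic (point_loop x0 x) (point_loop x0 y).
Proof. by rewrite -path_homotopic. Qed.

(** The class of a loop in [pi_n], for all [n] including [0]: a map from the point
    [I^0] is sent to the path component of its value, and homotopies of such maps
    are paths ([path_homotopic]).  This makes the arguments below uniform in
    [n]. *)
Definition hclass n X (x0 : X) : loops n x0 -> hpi n x0 :=
  match n return loops n x0 -> hpi n x0 with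
  | 0 => fun f => class_of (@path_related R X) (val f (cube0 R 0))
  | k.+1 => fun f => class_of (@homotopic R k.+1 X x0) f
  end.

Lemma hclass_eq n X (x0 : X) (f g : loops n x0) :
  hclass f = hclass g <-> homotopic f g.
Proof.
case: n f g => [|n] f g.
  rewrite -path_homotopic; apply: class_of_eq => [x|x y|x y z];
    rewrite !(path_related_homotopic _ _ x0).
  - exact: homotopic_refl.
  - exact: homotopic_sym.
  - exact: homotopic_trans.
apply: class_of_eq.
- exact: homotopic_refl.
- exact: homotopic_sym.
- exact: homotopic_trans.
Qed.

Lemma hclass_surj n X (x0 : X) (c : hpi n x0) : exists f, c = hclass f.
Proof.
case: n c => [|n] c.
  by exists (point_loop x0 (Defs.repr_of c)); rewrite /= class_of_repr.
by exists (Defs.repr_of c); rewrite /= class_of_repr.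
Qed.

Lemma hpi_base_hclass n X (x0 : X) : hpi_base n x0 = hclass (const_loop n x0).
Proof. by case: n. Qed.

Lemma homotopic_map n X Y (phi : smooth_map X Y) (x0 : X) (y0 : Y)
    (h : phi x0 = y0) (f g : loops n x0) :
  homotopic f g -> homotopic (loop_map h f) (loop_map h g).
Proof.
case=> H [H0 H1 Hb]; exists (comp_map phi H).
by split=> [t|t|t s bt] /=; rewrite ?H0 ?H1 ?Hb.
Qed.

Lemma hpi_map_hclass n X Y (phi : smooth_map X Y) (x0 : X) (y0 : Y)
    (h : phi x0 = y0) (f : loops n x0) :
  hpi_map h (hclass f) = hclass (loop_map h f).
Proof.
case: n f => [|n] f.
  pose g : loops 0 x0 := point_loop x0 (Defs.repr_of (hclass f)).
  have fg : homotopic g f.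
    by apply/hclass_eq; rewrite /= class_of_repr.
  exact: (hclass_eq _ _).2 (homotopic_map h fg).
apply: (hclass_eq _ _).2; apply: homotopic_map.
by apply/hclass_eq; rewrite /= class_of_repr.
Qed.

(** The class of a map of triples in [pi_(n+1)(X, A, a)]. *)
Definition rel_hclass n X (A : set X) (a : A) (f : rel_loops n a) : rel_hpi n a :=
  class_of (@rel_homotopic R n X A a) f.

Lemma rel_hclass_eq n X (A : set X) (a : A) (f g : rel_loops n a) :
  rel_hclass f = rel_hclass g <-> rel_homotopic f g.
Proof.
apply: class_of_eq.
- exact: rel_homotopic_refl.
- exact: rel_homotopic_sym.
- exact: rel_homotopic_trans.
Qed.

Lemma rel_hclass_surj n X (A : set X) (a : A) (c : rel_hpi n a) :
  exists f, c = rel_hclass f.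
Proof. by exists (Defs.repr_of c); rewrite /rel_hclass class_of_repr. Qed.

Lemma homotopic_boundary n X (A : set X) (a : A) (f g : rel_loops n a) :
  rel_homotopic f g -> homotopic (boundary_loop f) (boundary_loop g).
Proof.
case=> H [H0 H1 Hb HJ].
pose K := comp_map H (pair_map (comp_map (face_map R n) (fst_map _ (cube R 1)))
  (snd_map _ _)).
have KA ts : A (K ts).
  by apply: Hb; exists ord_max; left; rewrite mxE unlift_none.
exists (corestr_map KA); split=> [t|t|t s bt]; apply/val_inj => /=.
- exact: H0.
- exact: H1.
- exact/HJ/face_Jset.
Qed.

Lemma boundary_rel_hclass n X (A : set X) (a : A) (f : rel_loops n a) :
  boundary (rel_hclass f) = hclass (boundary_loop f).
Proof.
have H : rel_homotopic (Defs.repr_of (rel_hclass f)) f.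
  by apply/rel_hclass_eq; rewrite /rel_hclass class_of_repr.
have := (hclass_eq _ _).2 (homotopic_boundary H).
by case: n f H.
Qed.

(** The loop [p o f] in the base, for a map of triples [f] to the total space and
    the fiber. *)
Definition proj_loop n X Y (p : smooth_map X Y) (y : Y) (x : fiber p y)
  (f : rel_loops n x) : loops n.+1 y := in_sub (rel_loops_comp f).

Lemma fiber_hpi_map_rel_hclass n X Y (p : smooth_map X Y) (y : Y)
    (x : fiber p y) (f : rel_loops n x) :
  fiber_hpi_map (rel_hclass f) = hclass (proj_loop f).
Proof.
have [H [H0 H1 Hb HJ]] : rel_homotopic (Defs.repr_of (rel_hclass f)) f.
  by apply/rel_hclass_eq; rewrite /rel_hclass class_of_repr.
apply: (@hclass_eq n.+1 Y y (proj_loop _) _).2; exists (comp_map p H).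
split=> [t|t|t s bt] /=; rewrite ?H0 ?H1 //.
exact: Hb.
Qed.

Lemma homotopic_eq n X (x0 : X) (f g : loops n x0) :
  (forall t, val f t = val g t) -> homotopic f g.
Proof.
move=> fg; rewrite (_ : f = g); first exact: homotopic_refl.
exact/val_inj/smooth_map_eq.
Qed.

End Classes.

(** * The cube of dimension n + 1 as a product, and tame reparametrization *)

Section Packing.
Context {R : realType}.
Implicit Types X Y Z : diffeologicalType R.

(** [front_map] and [last_map] are the two projections of [I^(n+1) = I^n * I], and
    [join_map] is the pairing; [pack] and [unpack] are the resulting inverse
    diffeomorphisms between [I^n * I] and [I^(n+1)]. *)
Definition front_map n : smooth_map (cube R n.+1) (cube R n) :=
  to_set (fun t : cube R n.+1 => cube_front (set_valP t))
    (fun j => real_smooth_eq (fun t => esym (mxE _ _ 0 j))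
      (@real_smooth_coord R n.+1 (cube R n.+1) (lift ord_max j))).

Definition last_map n : smooth_map (cube R n.+1) (cube R 1) :=
  to_I (fun t : cube R n.+1 => cube_itv t ord_max)
    (@real_smooth_coord R _ _ ord_max).

Definition join_map n X (f : smooth_map X (cube R n)) (s : smooth_map X (cube R 1)) :
    smooth_map X (cube R n.+1) :=
  to_set (fun x => cube_join (set_valP (f x)) (cube_itv (s x) 0))
   (real_smooth_join
     (fun j => real_smooth_comp f (@real_smooth_coord R _ _ j)) (real_smooth_I s)).

Lemma last_mapE n (t : cube R n.+1) : val (last_map n t) 0 0 = val t 0 ord_max.
Proof. exact: to_IE. Qed.

Lemma front_mapE n (t : cube R n.+1) : val (front_map n t) = front (val t).
Proof. by []. Qed.

Lemma join_mapE n X (f : smooth_map X (cube R n)) s x :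
  val (join_map f s x) = join (val (f x)) (val (s x) 0 0).
Proof. by []. Qed.

Definition pack n : smooth_map (cube R n * cube R 1)%type (cube R n.+1) :=
  join_map (fst_map _ _) (snd_map _ _).

Definition unpack n : smooth_map (cube R n.+1) (cube R n * cube R 1)%type :=
  pair_map (front_map n) (last_map n).

Lemma packE n t s : val (pack n (t, s)) = join (val t) (val s 0 0).
Proof. by []. Qed.

Lemma packK n ts : unpack n (pack n ts) = ts.
Proof.
case: ts => t s; congr (_, _).
- by apply/val_inj; rewrite front_mapE packE front_join.
- by apply: cube1_eq; rewrite last_mapE packE join_last.
Qed.

Lemma unpackK n t : pack n (unpack n t) = t.
Proof.
by apply/val_inj; rewrite packE last_mapE front_mapE join_front.
Qed.

Lemma pack_face n t : pack n (t, cube0 R 1) = face_map R n t.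
Proof. by apply/val_inj; rewrite packE mxE. Qed.

Lemma bd_pack n t s : bd (val (pack n (t, s))) <->
  [\/ bd (val t), s = cube0 R 1 | s = cube1 R 1].
Proof.
rewrite packE bd_join; split; case=> H.
- by constructor 1.
- by constructor 2; apply: cube1_eq; rewrite H mxE.
- by constructor 3; apply: cube1_eq; rewrite H mxE.
- by constructor 1.
- by constructor 2; rewrite H mxE.
- by constructor 3; rewrite H mxE.
Qed.

Lemma pack_Lset n t s : Lset R n (val (pack n (t, s))) <->
  bd (val t) \/ s = cube0 R 1.
Proof.
rewrite /Lset /= front_join join_last; split=> [[_ []]|H]; [by left| |].
  by move=> H; right; apply: cube1_eq; rewrite H mxE.
split; first exact: (set_valP (pack n (t, s))).
by case: H => [|->]; [left|right; rewrite mxE].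
Qed.

Lemma pack_Jset n t s : Jset R n (val (pack n (t, s))) <->
  bd (val t) \/ s = cube1 R 1.
Proof.
rewrite /Jset /= front_join join_last; split=> [[_ []]|H]; [by left| |].
  by move=> H; right; apply: cube1_eq; rewrite H mxE.
split; first exact: (set_valP (pack n (t, s))).
by case: H => [|->]; [left|right; rewrite mxE].
Qed.

(** The reversal of the last coordinate; it exchanges [Lset] and [Jset]. *)
Definition flip n : smooth_map (cube R n.+1) (cube R n.+1) :=
  join_map (front_map n) (comp_map rev_I (last_map n)).

Lemma flip_pack n t s : flip n (pack n (t, s)) = pack n (t, rev_I s).
Proof.
apply/val_inj; rewrite join_mapE packE front_mapE packE front_join.
by congr (join _ (val (rev_I _) _ _)); apply: cube1_eq; rewrite last_mapE packE join_last.
Qed.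

(** The step function applied to every coordinate.  It is constant in [t_j] within
    distance [1/4] of [0] and of [1], so that every map that factors through it
    is tame ([tame_flat]). *)
Definition flat_row n (t : 'rV[R]_n) : 'rV[R]_n := \row_j step (t 0 j).

Lemma cube_flat n (t : 'rV[R]_n) : cube R n (flat_row t).
Proof. by move=> j; rewrite mxE; exact: step_itv. Qed.

Lemma step0 : step (0 : R) = 0. Proof. by rewrite step_eq0 ?invr_ge0. Qed.
Lemma step1 : step (1 : R) = 1. Proof. by rewrite step_eq1 //; lra. Qed.

Lemma Lset_flat n (t : 'rV[R]_n.+1) : Lset R n t -> Lset R n (flat_row t).
Proof.
case=> _ Lt; split; first exact: cube_flat.
case: Lt => [[j]|t0]; last by right; rewrite mxE t0 step0.
rewrite mxE => Hj; left; exists j; rewrite !mxE.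
by case: Hj => ->; [left; exact: step0|right; exact: step1].
Qed.

Lemma real_smooth_flat n (A : set 'rV[R]_n) j :
  real_smooth (fun t : A => flat_row (val t) 0 j).
Proof.
apply: (real_smooth_eq _ (real_smooth_step (@real_smooth_coord R n A j))) => t.
by rewrite mxE.
Qed.

Definition flat n : smooth_map (cube R n) (cube R n) :=
  to_set (fun t : cube R n => cube_flat (val t)) (@real_smooth_flat n _).

Definition flat_L n : smooth_map (Lset R n) (Lset R n) :=
  to_set (fun t : Lset R n => Lset_flat (set_valP t)) (@real_smooth_flat n.+1 _).

Lemma face_preserving_flat n : face_preserving (flat n).
Proof. by move=> t j a [] -> tj; rewrite mxE tj ?step0 ?step1. Qed.

Lemma flat_set_coord n (t : 'rV[R]_n) j (a : R) : a = 0 \/ a = 1 ->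
  `|t 0 j - a| <= 4^-1 -> flat_row (set_coord t j a) = flat_row t.
Proof.
move=> Ha; rewrite ler_norml => /andP[h1 h2].
apply/rowP => k; rewrite !mxE; case: eqP => // ->.
case: Ha h1 h2 => -> h1 h2.
  by rewrite !step_eq0 //; lra.
by rewrite !step_eq1 //; lra.
Qed.

Lemma tame_flat n (K : set 'rV[R]_n) (Y : Type) (f : K -> Y) :
  (forall t s : K, flat_row (val t) = flat_row (val s) -> f t = f s) -> tame f.
Proof.
move=> Hf; exists 4^-1; split; first by lra.
by move=> t s j a Ha tj ts; apply: Hf; rewrite ts flat_set_coord.
Qed.

(** The step function, as a self-map of the interval. *)
Definition step_I : smooth_map (cube R 1) (cube R 1) :=
  to_I (fun s : cube R 1 => step_itv (val s 0 0))
    (real_smooth_step (@real_smooth_coord R _ _ 0)).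

Lemma step_I0 : step_I (cube0 R 1) = cube0 R 1.
Proof. by apply: cube1_eq; rewrite to_IE !mxE step0. Qed.

Lemma step_I1 : step_I (cube1 R 1) = cube1 R 1.
Proof. by apply: cube1_eq; rewrite to_IE !mxE step1. Qed.

Lemma flat_pack n t s : flat n.+1 (pack n (t, s)) = pack n (flat n t, step_I s).
Proof.
apply/val_inj/rowP => j; rewrite packE to_IE mxE packE.
by case: (unliftP ord_max j) => [i|] ->; rewrite ?join_lift ?join_last ?mxE.
Qed.

(** The conjugate of [flat] by the reversal of the last coordinate. *)
Definition flip_flat n : smooth_map (cube R n.+1) (cube R n.+1) :=
  comp_map (flip n) (comp_map (flat n.+1) (flip n)).

Lemma flip_flat_pack n t s :
  flip_flat n (pack n (t, s)) = pack n (flat n t, rev_I (step_I (rev_I s))).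
Proof.
by change (flip n (flat n.+1 (flip n (pack n (t, s)))) =
  pack n (flat n t, rev_I (step_I (rev_I s)))); rewrite flip_pack flat_pack flip_pack.
Qed.

Lemma face_preserving_flip_flat n : face_preserving (flip_flat n).
Proof.
move=> t j a Ha; rewrite -(unpackK t); case: (unpack n t) => {}t s.
rewrite flip_flat_pack !packE.
case: (unliftP ord_max j) => [i|] ->.
  by rewrite !join_lift; exact: face_preserving_flat.
rewrite !join_last !to_IE => ->.
by case: Ha => ->; rewrite ?subr0 ?subrr ?step0 ?step1 ?subr0 ?subrr.
Qed.

End Packing.

(** * Lifting in a weak fibration *)

Section Lifting.
Context {R : realType}.
Variables (E B : diffeologicalType R) (p : smooth_map E B).
Hypothesis wp : weak_fibration p.

(** The lifting property without tameness hypotheses, at the price of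
    reparametrizing the data by [flat].  The initial data [f] is given on the
    whole cube, but only its values on [L^n] matter, and only its restriction to
    [L^n] has to be smooth. *)
Lemma lift_flat n (f : cube R n.+1 -> E) (g : smooth_map (cube R n.+1) B) :
  smooth (fun x : Lset R n => f (L_incl x)) ->
  (forall t, Lset R n (val t) -> p (f t) = g t) ->
  exists G : smooth_map (cube R n.+1) E,
    (forall t, Lset R n (val t) -> G t = f (flat n.+1 t)) /\
    (forall t, p (G t) = g (flat n.+1 t)).
Proof.
move=> sf fg.
have fl (x : Lset R n) : L_incl (flat_L n x) = flat n.+1 (L_incl x).
  exact/val_inj.
have [||x|G [Gf Gg]] := @wp n (comp_map (SmoothMap sf) (flat_L n))
  (comp_map g (flat n.+1)).
- apply: tame_flat => t s ts; have ts' : flat_L n t = flat_L n s by exact/val_inj.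
  exact: (congr1 (fun x => f (L_incl x)) ts').
- apply: tame_flat => t s ts; have ts' : flat n.+1 t = flat n.+1 s by exact/val_inj.
  exact: (congr1 g ts').
- change (p (f (L_incl (flat_L n x))) = g (flat n.+1 (L_incl x))).
  by rewrite fl; apply: fg; rewrite -fl; exact: (set_valP (flat_L n x)).
exists G; split=> // t Lt; pose x : Lset R n := in_sub Lt.
have -> : t = L_incl x by exact/val_inj.
by rewrite -fl; exact: Gf.
Qed.

End Lifting.

(** * The relative homotopy sets of the fiber and those of the base *)

Section Fibration.
Context {R : realType}.
Variables (E B : diffeologicalType R) (p : smooth_map E B).
Hypothesis wp : weak_fibration p.
Variables (b : B) (e : fiber p b).

Local Notation F := (fiber p b).
Local Notation I0 := (cube0 R 1).
Local Notation I1 := (cube1 R 1).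

Lemma bd_pack0 n t : bd (val (pack n (t, I0))).
Proof. by apply/bd_pack; constructor 2. Qed.

(** A loop [g] of the base, reparametrized by [flip_flat], is lifted with the
    constant value [e] prescribed on [J].  The lifting property prescribes values on [L]
    instead, whence [flip]. *)
Lemma fiber_hpi_map_surj n (c : hpi n.+1 b) :
  exists d : rel_hpi n e, fiber_hpi_map d = c.
Proof.
have [g ->] := hclass_surj c.
have [||G [Ge Gp]] := lift_flat wp (f := fun=> val e)
    (g := comp_map (val g) (flip n)).
- exact: smooth_cst.
- move=> t; rewrite -(unpackK t); case: (unpack n t) => {}t s /pack_Lset ts.
  rewrite (fiber_eq e); apply/esym; change (val g (flip n (pack n (t, s))) = b).
  rewrite flip_pack; apply: (set_valP g); apply/bd_pack.
  by case: ts => [|->]; [constructor 1|constructor 3; exact: rev_I0].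
have pG t : p (G (flip n t)) = val g (flip_flat n t) by exact: Gp.
have Grel : rel_loops n e (comp_map G (flip n)).
  split=> [t bt|t].
    change (p (G (flip n t)) = b); rewrite pG; apply: (set_valP g).
    exact: face_preserving_bd (@face_preserving_flip_flat _ n) bt.
  rewrite -(unpackK t); case: (unpack n t) => {}t s /pack_Jset ts.
  apply: Ge; rewrite flip_pack; apply/pack_Lset.
  by case: ts => [|->]; [left|right; exact: rev_I1].
exists (rel_hclass (in_sub Grel : rel_loops n e)).
rewrite fiber_hpi_map_rel_hclass; apply/hclass_eq/homotopic_sym.
apply: (homotopic_reparam (psi := flip_flat n)); last exact: pG.
exact: face_preserving_flip_flat.
Qed.

(** Precomposition with a face-preserving map preserves maps of triples. *)
Lemma rel_reparam n (f : rel_loops n e) (psi : smooth_map (cube R n.+1) (cube R n.+1)) :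
  face_preserving psi -> rel_loops n e (comp_map (val f) psi).
Proof.
move=> Hpsi; split=> [t bt|t Jt].
- exact: (set_valP f).1 _ (face_preserving_bd Hpsi bt).
- exact: (set_valP f).2 _ (face_preserving_Jset Hpsi Jt).
Qed.

(** The identification of [I^(n+2)] with [I^(n+1) * I] for which
    [L^(n+1)] is the union of [I^(n+1) * {0, 1}] and [J^n * I], where a homotopy
    of maps of triples is prescribed.  [homotopy_point] is
    [(t, s, r) |-> (t, 1 - r)]. *)
Definition homotopy_point n : smooth_map (cube R n.+2) (cube R n.+1) :=
  join_map (comp_map (front_map n) (front_map n.+1)) (comp_map rev_I (last_map n.+1)).

(** The time [(t, s, r) |-> s]. *)
Definition homotopy_time n : smooth_map (cube R n.+2) (cube R 1) :=
  comp_map (last_map n) (front_map n.+1).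

(** The inverse identification [((t, r), s) |-> (t, s, 1 - r)]. *)
Definition homotopy_cube n : smooth_map (cube R n.+1 * cube R 1)%type (cube R n.+2) :=
  join_map (join_map (comp_map (front_map n) (fst_map _ _)) (snd_map _ _))
    (comp_map rev_I (comp_map (last_map n) (fst_map _ _))).

Lemma front_pack n (t : cube R n) s : front_map n (pack n (t, s)) = t.
Proof. by have /(congr1 fst) := packK (t, s). Qed.

Lemma last_pack n (t : cube R n) s : last_map n (pack n (t, s)) = s.
Proof. by have /(congr1 snd) := packK (t, s). Qed.

Lemma homotopy_point_pack n (t : cube R n) s r :
  homotopy_point n (pack n.+1 (pack n (t, s), r)) = pack n (t, rev_I r).
Proof.
change (pack n (front_map n (front_map n.+1 (pack n.+1 (pack n (t, s), r))),
  rev_I (last_map n.+1 (pack n.+1 (pack n (t, s), r)))) = pack n (t, rev_I r)).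
by rewrite !front_pack last_pack.
Qed.

Lemma homotopy_time_pack n (t : cube R n) s r :
  homotopy_time n (pack n.+1 (pack n (t, s), r)) = s.
Proof.
change (last_map n (front_map n.+1 (pack n.+1 (pack n (t, s), r))) = s).
by rewrite front_pack last_pack.
Qed.

Lemma homotopy_cube_pack n (t : cube R n) r s :
  homotopy_cube n (pack n (t, r), s) = pack n.+1 (pack n (t, s), rev_I r).
Proof.
change (pack n.+1 (pack n (front_map n (pack n (t, r)), s),
  rev_I (last_map n (pack n (t, r)))) = pack n.+1 (pack n (t, s), rev_I r)).
by rewrite !front_pack last_pack.
Qed.

(** A homotopy [H] in the base between the projections of [f0] and [f1] is lifted,
    up to reparametrization, to a homotopy that starts at [f0], ends at [f1] and
    is constant on [J]. *)
Lemma fiber_hpi_map_inj n : injective (@fiber_hpi_map R n E B p b e).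
Proof.
move=> c d; have [f0 ->] := rel_hclass_surj c; have [f1 ->] := rel_hclass_surj d.
rewrite !fiber_hpi_map_rel_hclass => /hclass_eq [H [H0 H1 Hb]].
have fJ (f : rel_loops n e) t : Jset R n (val t) -> val f t = val e.
  exact: (set_valP f).2.
pose u := homotopy_point n; pose tm := homotopy_time n.
(* The initial data of the lift: on [L] the two cases agree for times strictly
   between 0 and 1, because both are then equal to [e]. *)
pose f x := if val (tm x) 0 0 < 2^-1 then val f0 (u x) else val f1 (u x).
pose g := comp_map H (pair_map u tm).
have Lcase x : Lset R n.+1 (val x) ->
    [\/ tm x = I0, tm x = I1 | Jset R n (val (u x))].
  rewrite -(unpackK x); case: (unpack n.+1 x) => {}x r.
  rewrite -(unpackK x); case: (unpack n x) => {}x s.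
  rewrite /u /tm homotopy_point_pack homotopy_time_pack.
  case/pack_Lset => [/bd_pack[bx||]|->]; [|by constructor 1|by constructor 2|].
    by constructor 3; apply/pack_Jset; left.
  by constructor 3; apply/pack_Jset; right; exact: rev_I0.
have sf : smooth (fun x : Lset R n.+1 => f (L_incl x)).
  have sL : smooth (@L_incl R n.+1) by [].
  pose uL := comp_map u (SmoothMap sL).
  apply: (@smooth_glue _ _ _ (comp_map (val f0) uL) (comp_map (val f1) uL)
    (fun x : Lset R n.+1 => val (tm (L_incl x)) 0 0) 0 1).
  - exact: (real_smooth_I (comp_map tm (SmoothMap sL))).
  - lra.
  - move=> x; case: (Lcase (L_incl x) (set_valP x)) => [->|->|Jx] h.
    + by move: h; rewrite mxE ltxx.
    + by move: h; rewrite mxE ltxx andbF.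
    + by rewrite /= !fJ.
have fg x : Lset R n.+1 (val x) -> p (f x) = g x.
  move=> Lx; change (p (f x) = H (u x, tm x)); rewrite /f.
  case: (Lcase x Lx) => [->|->|Jx].
  - by rewrite mxE invr_gt0 ltr0n H0.
  - by rewrite mxE ifF ?H1 //; apply/negbTE; rewrite -leNgt; lra.
  - by rewrite !fJ // if_same Hb ?(fiber_eq e) //; exact: Jset_bd Jx.
have [G [Gf Gg]] := lift_flat wp sf fg.
pose psi := @flip_flat R n.
have fp : face_preserving psi by exact: face_preserving_flip_flat.
have uflat v s : u (flat _ (homotopy_cube n (v, s))) = psi v.
  rewrite -(unpackK v); case: (unpack n v) => {}v r.
  rewrite homotopy_cube_pack !flat_pack /u homotopy_point_pack.
  by rewrite /psi flip_flat_pack.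
have tmflat v s : tm (flat _ (homotopy_cube n (v, s))) = step_I s.
  rewrite -(unpackK v); case: (unpack n v) => {}v r.
  by rewrite homotopy_cube_pack !flat_pack /tm homotopy_time_pack.
have cubeL v s : [\/ s = I0, s = I1 | Jset R n (val v)] ->
    Lset R n.+1 (val (homotopy_cube n (v, s))).
  rewrite -(unpackK v); case: (unpack n v) => {}v r.
  rewrite homotopy_cube_pack => h; apply/pack_Lset.
  case: h => [->|->|/pack_Jset[bv|->]].
  - by left; apply/bd_pack; constructor 2.
  - by left; apply/bd_pack; constructor 3.
  - by left; apply/bd_pack; constructor 1.
  - by right; exact: rev_I1.
pose f0' : rel_loops n e := in_sub (rel_reparam f0 fp).
pose f1' : rel_loops n e := in_sub (rel_reparam f1 fp).
have h0 : rel_homotopic f0 f0' by apply: (rel_homotopic_reparam fp).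
have h1 : rel_homotopic f1 f1' by apply: (rel_homotopic_reparam fp).
apply/rel_hclass_eq; apply: rel_homotopic_trans h0 _.
apply: rel_homotopic_trans (rel_homotopic_sym h1).
exists (comp_map G (homotopy_cube n)); split.
- move=> t; change (G (homotopy_cube n (t, I0)) = val f0 (psi t)).
  rewrite Gf; last by apply: cubeL; constructor 1.
  by rewrite /f uflat tmflat step_I0 mxE invr_gt0 ltr0n.
- move=> t; change (G (homotopy_cube n (t, I1)) = val f1 (psi t)).
  rewrite Gf; last by apply: cubeL; constructor 2.
  by rewrite /f uflat tmflat step_I1 mxE ifF //; apply/negbTE; rewrite -leNgt; lra.
- move=> t s bt; change (p (G (homotopy_cube n (t, s))) = b).
  rewrite Gg; change (H (u (flat _ (homotopy_cube n (t, s))),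
    tm (flat _ (homotopy_cube n (t, s)))) = b).
  by rewrite uflat Hb //; exact: face_preserving_bd bt.
- move=> t s Jt; change (G (homotopy_cube n (t, s)) = val e).
  rewrite Gf; last by apply: cubeL; constructor 3.
  have Jpsi := face_preserving_Jset fp Jt.
  by rewrite /f uflat !fJ // if_same.
Qed.

End Fibration.

(** * Exactness *)

Section Exactness.
Context {R : realType}.

Local Notation I0 := (cube0 R 1).
Local Notation I1 := (cube1 R 1).

Lemma smooth_id (X : diffeologicalType R) : smooth (id : X -> X).
Proof. by []. Qed.
Definition id_map (X : diffeologicalType R) : smooth_map X X :=
  SmoothMap (@smooth_id X).

(** The inclusion [z |-> (z, s)] of a slice. *)
Definition slice_map (Z : diffeologicalType R) (s : cube R 1) :
    smooth_map Z (Z * cube R 1)%type :=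
  pair_map (id_map Z) (cst_map Z s).

(** Exactness at [pi_n(A, a)], for any pair: a null homotopy in [X] of a loop of [A]
    is, as a map on [I^(n+1)], the same thing as a map of triples whose
    restriction to the face of last coordinate [0] is this loop. *)
Lemma exact_at_boundary n (X : diffeologicalType R) (A : set X) (a : A) :
  exact_at (@boundary R n X A a) (hpi_map (erefl (incl_map A a)))
    (hpi_base n (incl_map A a)).
Proof.
apply/seteqP; split=> [_ [d _ <-]|c].
  have [f ->] := rel_hclass_surj d.
  change (hpi_map (erefl (incl_map A a)) (boundary (rel_hclass f)) =
    hpi_base n (incl_map A a)).
  rewrite boundary_rel_hclass hpi_map_hclass hpi_base_hclass; apply/hclass_eq.
  have [fA fJ] := set_valP f.
  exists (comp_map (val f) (pack n)); split=> [t|t|t s bt].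
  - exact: (congr1 (val f) (pack_face t)).
  - by apply: fJ; apply/pack_Jset; right.
  - by apply: fJ; apply/pack_Jset; left.
have [f ->] := hclass_surj c.
change (hpi_map (erefl (incl_map A a)) (hclass f) = hpi_base n (incl_map A a) ->
  range (@boundary R n X A a) (hclass f)).
rewrite hpi_map_hclass hpi_base_hclass => /hclass_eq [H [H0 H1 Hb]].
have Krel : rel_loops n a (comp_map H (unpack n)).
  split=> t; rewrite -(unpackK t); case: (unpack n t) => {}t s ts.
    change (A (H (unpack n (pack n (t, s))))); rewrite packK.
    case/bd_pack: ts => [bt|->|->].
    - by rewrite Hb //; exact: (set_valP a).
    - by rewrite H0; exact: (set_valP (val f t)).
    - by rewrite H1; exact: (set_valP a).
  change (H (unpack n (pack n (t, s))) = val a); rewrite packK.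
  by case/pack_Jset: ts => [bt|->]; [exact: Hb|exact: H1].
exists (rel_hclass (in_sub Krel : rel_loops n a)) => //.
rewrite boundary_rel_hclass; apply/hclass_eq/homotopic_eq => t.
apply/val_inj; change (H (unpack n (face_map R n t)) = val (val f t)).
by rewrite -pack_face packK H0.
Qed.

Variables (E B : diffeologicalType R) (p : smooth_map E B).
Hypothesis wp : weak_fibration p.
Variables (b : B) (e : fiber p b).

Local Notation F := (fiber p b).

(** If the projection of a loop [f] of the total space is null homotopic, lifting
    the homotopy with initial value [f], both reparametrized by [flat], deforms
    [f o flat], hence [f], to a loop of the fiber. *)
Lemma exact_at_total n :
  exact_at (hpi_map (n := n) (erefl (incl_map F e)))
    (hpi_map (fiber_eq e)) (hpi_base n b).
Proof.
apply/seteqP; split=> [_ [c _ <-]|c].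
  have [f ->] := hclass_surj c.
  change (hpi_map (fiber_eq e) (hpi_map (erefl (incl_map F e)) (hclass f)) =
    hpi_base n b).
  rewrite !hpi_map_hclass hpi_base_hclass.
  by apply/hclass_eq/homotopic_eq => t; exact: (fiber_eq (val f t)).
have [f ->] := hclass_surj c.
change (hpi_map (fiber_eq e) (hclass f) = hpi_base n b -> range
  (hpi_map (erefl (incl_map F e))) (hclass f)).
rewrite hpi_map_hclass hpi_base_hclass => /hclass_eq [H [H0 H1 Hb]].
have fb t : bd (val t) -> val f t = val e by exact: (set_valP f).
have [||G [Gf Gg]] := @lift_flat R E B p wp n (val f \o front_map n)
    (comp_map H (unpack n)).
- have sL : smooth (@L_incl R n) by [].
  exact: (smooth_funP (comp_map (val f) (comp_map (front_map n) (SmoothMap sL)))).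
- move=> t; rewrite -(unpackK t); case: (unpack n t) => {}t s Lts.
  change (p (val f (front_map n (pack n (t, s)))) = H (unpack n (pack n (t, s)))).
  rewrite front_pack packK; case/pack_Lset: Lts => [bt|->].
    by rewrite fb // Hb // (fiber_eq e).
  by rewrite H0.
have fpf : face_preserving (@flat R n) by exact: face_preserving_flat.
have Kf t s : bd (val t) \/ s = I0 -> G (pack n (t, s)) = val f (flat n t).
  move=> ts; rewrite Gf; last exact/pack_Lset.
  by rewrite flat_pack; congr (val f _); exact: front_pack.
have Kp t s : p (G (pack n (t, s))) = H (flat n t, step_I s).
  by rewrite Gg flat_pack; congr (H _); exact: packK.
pose k := comp_map G (comp_map (pack n) (slice_map (cube R n) I1)).
have kF t : F (k t).
  by change (p (G (pack n (t, I1))) = b); rewrite Kp step_I1 H1.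
have kl : loops n e (corestr_map kF).
  move=> t bt; apply/val_inj; change (G (pack n (t, I1)) = val e).
  by rewrite Kf ?fb //; [exact: face_preserving_bd|left].
exists (hclass (in_sub kl : loops n e)) => //.
rewrite hpi_map_hclass; apply/hclass_eq/homotopic_sym.
have fl : loops n (incl_map F e) (comp_map (val f) (flat n)).
  by move=> t bt; apply: fb; exact: face_preserving_bd bt.
pose f' : loops n (incl_map F e) := in_sub fl.
have h : homotopic f f' by apply: (homotopic_reparam fpf).
apply: homotopic_trans h _.
exists (comp_map G (pack n)); split=> [t|t|t s bt].
- by apply: Kf; right.
- by [].
- change (G (pack n (t, s)) = val e).
  by rewrite Kf ?fb //; [exact: face_preserving_bd|left].
Qed.

(** A loop of the total space is a map of triples. *)
Lemma loop_rel n (f : loops n.+1 (incl_map F e)) : rel_loops n e (val f).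
Proof.
have fb := set_valP f; split=> t Ht; last exact/fb/(Jset_bd Ht).
by rewrite fb //; exact: (set_valP e).
Qed.

(** The map [(t, s) |-> (t, hi_I s)], which waits on the face of last coordinate [0]
    during the first half of the time. *)
Definition wait_map n : smooth_map (cube R n.+1) (cube R n.+1) :=
  join_map (front_map n) (comp_map hi_I (last_map n)).

Lemma wait_pack n (t : cube R n) s : wait_map n (pack n (t, s)) = pack n (t, hi_I s).
Proof.
change (pack n (front_map n (pack n (t, s)), hi_I (last_map n (pack n (t, s)))) =
  pack n (t, hi_I s)).
by rewrite front_pack last_pack.
Qed.

Lemma hi_I_0 : hi_I I0 = I0.
Proof. by apply: hi_I0; rewrite mxE; lra. Qed.

Lemma face_preserving_wait n : face_preserving (wait_map n).
Proof.
move=> t j a Ha; rewrite -(unpackK t); case: (unpack n t) => {}t s.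
rewrite wait_pack !packE; case: (unliftP ord_max j) => [i|] ->.
  by rewrite !join_lift.
rewrite !join_last; case: Ha => -> Hs.
  by rewrite (_ : s = I0) ?hi_I_0 ?mxE //; apply: cube1_eq; rewrite Hs mxE.
by rewrite (_ : s = I1) ?hi_I1 ?mxE //; apply: cube1_eq; rewrite Hs mxE.
Qed.

(** Exactness at [pi_(n+1)(B, b)], read through the bijection with the relative
    homotopy sets.  If the boundary of [f] is null homotopic in the fiber, by
    [h], then gluing [h] to [f] along this boundary gives a loop of the total
    space; its projection is that of [f], preceded by a constant. *)
Lemma exact_base n (c : hpi n.+1 b) :
  (exists x, hpi_map (fiber_eq e) x = c) <->
  exists2 d : rel_hpi n e, fiber_hpi_map d = c & boundary d = hpi_base n e.
Proof.
split=> [[x <-]|[d <-]].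
  have [f ->] := hclass_surj x.
  pose f' : rel_loops n e := in_sub (loop_rel f).
  exists (rel_hclass f').
    rewrite fiber_hpi_map_rel_hclass hpi_map_hclass.
    by apply/hclass_eq/homotopic_eq.
  rewrite boundary_rel_hclass hpi_base_hclass; apply/hclass_eq/homotopic_eq => t.
  apply/val_inj; change (val f (face_map R n t) = val e).
  by apply: (set_valP f); rewrite -pack_face; apply/bd_pack; constructor 2.
have [f ->] := rel_hclass_surj d.
rewrite boundary_rel_hclass hpi_base_hclass => /hclass_eq [h [h0 h1 hb]].
have [fF fJ] := set_valP f.
(* The last coordinate is used as time: first [h] backwards, then [f]. *)
pose H1 := comp_map (incl_map F) (comp_map h (time_map rev_I)).
pose H2 := comp_map (val f) (pack n).
have H1E t s : H1 (t, s) = val (h (t, rev_I s)) by [].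
have H2E t s : H2 (t, s) = val f (pack n (t, s)) by [].
have H12 t : H1 (t, I1) = H2 (t, I0).
  by rewrite H1E H2E rev_I1 h0 pack_face.
pose K := comp_map (concat H12) (unpack n).
have KE t s : K (pack n (t, s)) = concat H12 (t, s).
  exact: (congr1 (concat H12) (packK (t, s))).
have Kl : loops n.+1 (incl_map F e) K.
  move=> t; rewrite -(unpackK t); case: (unpack n t) => {}t s ts.
  rewrite KE; case/bd_pack: ts => [bt|->|->].
  - apply: (concat_inv H12 (P := fun _ x => x = incl_map F e)) => s'.
      by rewrite H1E hb.
    by rewrite H2E fJ //; apply/pack_Jset; left.
  - by rewrite concat0 H1E rev_I0 h1.
  - by rewrite concat1 H2E fJ //; apply/pack_Jset; right.
exists (hclass (in_sub Kl : loops n.+1 (incl_map F e))).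
rewrite hpi_map_hclass fiber_hpi_map_rel_hclass; apply/hclass_eq/homotopic_sym.
apply: (homotopic_reparam (@face_preserving_wait n)) => t.
rewrite -(unpackK t); case: (unpack n t) => {}t s.
change (p (K (pack n (t, s))) = p (val f (wait_map n (pack n (t, s))))).
rewrite KE wait_pack concatE; case: ifP => // s2.
rewrite H1E (fiber_eq (h (t, rev_I (lo_I s)))) hi_I0; last by rewrite ltW // (lt_trans s2) //; lra.
apply/esym; exact: (set_valP (proj_loop f) _ (bd_pack0 t)).
Qed.

End Exactness.

Theorem proposition4p7 (R : realType) (E B : diffeologicalType R)
    (p : smooth_map E B) (wp : weak_fibration p) (b : B) (e : fiber p b) :
  let i := incl_map (fiber p b) in
  let i_ n : hpi n e -> hpi n (i e) := hpi_map (erefl (i e)) in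
  let p_ n : hpi n (i e) -> hpi n b := hpi_map (fiber_eq e) in
  exists Delta' : forall n : nat, hpi n.+1 b -> hpi n e,
    (* Delta' is the boundary map composed with the inverse of p_* *)
    (forall n, bijective (@fiber_hpi_map R n E B p b e) /\
       forall c : rel_hpi n e, Delta' n (fiber_hpi_map c) = boundary c) /\
    (forall n, [/\ i_ n (hpi_base n e) = hpi_base n (i e),
                   p_ n (hpi_base n (i e)) = hpi_base n b
                 & Delta' n (hpi_base n.+1 b) = hpi_base n e]) /\
    (forall n, [/\ exact_at (Delta' n) (i_ n) (hpi_base n (i e)),
                   exact_at (i_ n) (p_ n) (hpi_base n b)
                 & exact_at (p_ n.+1) (Delta' n) (hpi_base n e)]).
Proof.
move=> i i_ p_.
pose q n := @fiber_hpi_map R n E B p b e.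
pose q1 n (c : hpi n.+1 b) : rel_hpi n e := sval (cid (fiber_hpi_map_surj wp e c)).
have q1K n : cancel (q1 n) (q n) by move=> c; exact: (svalP (cid (fiber_hpi_map_surj wp e c))).
have qK n : cancel (q n) (q1 n).
  by move=> d; apply: (fiber_hpi_map_inj wp); exact: q1K.
have i0 n : i_ n (hpi_base n e) = hpi_base n (i e).
  rewrite /i_ !hpi_base_hclass hpi_map_hclass.
  by apply/hclass_eq/homotopic_eq.
have p0 n : p_ n (hpi_base n (i e)) = hpi_base n b.
  rewrite /p_ !hpi_base_hclass hpi_map_hclass.
  by apply/hclass_eq/homotopic_eq => t; exact: (fiber_eq e).
have ex n : exact_at (p_ n.+1) (fun c => boundary (q1 n c)) (hpi_base n e).
  apply/seteqP; split=> c.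
    case=> x _ xc; have /exact_base [d <- dE] : exists x, p_ n.+1 x = c by exists x.
    by rewrite /preimage /= (qK n d).
  move=> c0; have [|x xc] := (exact_base e c).2 _; last by exists x.
  by exists (q1 n c); [exact: q1K|exact: c0].
exists (fun n c => boundary (q1 n c)); split.
  move=> n; split; first by exists (q1 n).
  by move=> c; congr boundary; exact: qK.
split=> n; split=> //.
- have : range (p_ n.+1) (hpi_base n.+1 b) by exists (hpi_base n.+1 (i e)).
  by rewrite (ex n).
- apply: (etrans _ (exact_at_boundary n e)); apply/seteqP; split=> _ [c _ <-].
    by exists (q1 n c).
  by exists (q n c) => //; congr boundary; exact: qK.
- exact: exact_at_total.
Qed.
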